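(* Let $m\ge 2$, $d\ge 1$ and $k\ge 0$ be integers, and let \[ \mathbb{P}_m=\det\begin{bmatrix} x_1 & x_1^2 & \cdots & x_1^{2^{m-1}}\\ x_2 & x_2^2 & \cdots & x_2^{2^{m-1}}\\ \vdots & \vdots & \ddots & \vdots\\ x_m & x_m^2 & \cdots & x_m^{2^{m-1}}\end{bmatrix}\in(\mathbb{Z}/2)[x_1,x_2,\ldots,x_m] \] be the Dickson polynomial in $m$ variables. If \[ \frac{1}{x_2x_3\cdots x_m}\left(\frac{1}{x_1}\mathbb{P}_m\right)^{k+1}\notin (x_1^d,x_2^d,\ldots,x_m^d), \] where the right-hand side is the ideal of $(\mathbb{Z}/2)[x_1,\ldots,x_m]$ generated by $x_1^d,\ldots,x_m^d$, then every mass distribution $\mu$ in $\mathbb{R}^d$ admits an equipartition by a collection of $2k+1$ parallel hyperplanes and $m-1$ additional non-parallel hyperplanes in $(2k+2)\times 2\times\cdots\times 2$ boxes (with $m-1$ factors $2$); that is, such hyperplanes exist for which each of the $(2k+2)2^{m-1}$ boxes has $\mu$-measure $\frac{1}{(2k+2)2^{m-1}}\mu(\mathbb{R}^d)$.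
   Context: A mass distribution in $\mathbb{R}^d$ is a finite Borel measure $\mu$ of the form $\mu(A)=\int_A f\,dx$ for an integrable density function $f:\mathbb{R}^d\to\mathbb{R}$ (integration with respect to Lebesgue measure), such that every nonempty open subset of $\mathbb{R}^d$ has positive $\mu$-measure. The additional hyperplanes being non-parallel means that none of them is parallel to the hyperplanes of the parallel collection and no two of them are parallel to each other. Boxes: a collection of $l$ parallel hyperplanes divides $\mathbb{R}^d$ into $l+1$ consecutive regions, and each additional hyperplane divides $\mathbb{R}^d$ into two half-spaces; the $(l+1)\times 2\times\cdots\times 2$ boxes are the intersections of one of the $l+1$ regions with one half-space of each of the $m-1$ additional hyperplanes. A single hyperplane counts as a collection of one parallel hyperplane. The Dickson polynomial $\mathbb{P}_m$ is the product of all nonzero $\mathbb{Z}/2$-linear combinations of $x_1,\ldots,x_m$, so it is divisible by $x_1x_2\cdots x_m$, and the quotient above denotes a polynomial. *)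

(* Defs.v *)
From HB Require Import structures.
From mathcomp Require Import all_boot all_order all_algebra.
(* The notations of multinomials clash with those of mathcomp-analysis. *)
From mathcomp Require mpoly.
Import -(notations) mpoly.
From mathcomp Require Import all_classical all_reals all_analysis.

Set Implicit Arguments.
Unset Strict Implicit.
Unset Printing Implicit Defensive.

Import Order.TTheory GRing.Theory Num.Theory.
Import numFieldNormedType.Exports.

Local Open Scope classical_set_scope.
Local Open Scope ring_scope.

(** * Polynomials over Z/2 *)

Notation mvar i := (mpolyX 'F_2 (mnm1 i)).

Definition dickson (m : nat) : mpoly m 'F_2 :=
  \det (\matrix_(i < m, j < m) mvar i ^+ (2 ^ j)).

Definition ideal_generated (A : comPzRingType) (n : nat) (g : 'I_n -> A) :
    set A :=
  [set p | exists c : 'I_n -> A, p = \sum_(i < n) c i * g i].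

(* The divisions of polynomials that occur in the theorem are exact. *)
Lemma dickson_divisible (m : nat) :
  exists q : mpoly m 'F_2, dickson m = (\prod_(i < m) mvar i) * q.
Proof.
pose B : 'M[mpoly m 'F_2]_m := \matrix_(i, j) mvar i ^+ (2 ^ j).-1.
exists (\det B).
pose D : 'rV[mpoly m 'F_2]_m := \row_i mvar i.
have -> : \prod_(i < m) mvar i = \det (diag_mx D).
  by rewrite det_diag; apply: eq_bigr => i _; rewrite mxE.
rewrite -det_mulmx /dickson; congr (\det _).
apply/matrixP => i j; rewrite mul_diag_mx !mxE -exprS prednK //.
by rewrite expn_gt0.
Qed.

(** * Lebesgue measure on R^d

    The points of R^d are row vectors, with their product topology, and the
    measurable sets are the Borel sets.  Lebesgue measure is transported from
    the iterated product measure on tuples of reals. *)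

(* The library proves this fact, but only registers it for products of
   subprobability measures. *)
Lemma product_sigma_finite d1 d2 (T1 : measurableType d1)
    (T2 : measurableType d2) (R : realType)
    (m1 : {sigma_finite_measure set T1 -> \bar R})
    (m2 : {sigma_finite_measure set T2 -> \bar R}) :
  sigma_finite setT (m1 \x m2)%E.
Proof.
have /sigma_finiteP[F [TF ndF Foo]] := sigma_finiteT m1.
have /sigma_finiteP[G [TG ndG Goo]] := sigma_finiteT m2.
exists (fun n => F n `*` G n).
  rewrite -setXTT TF TG predeqE => -[x y]; split.
    move=> [/= [n _ Fnx] [k _ Gky]]; exists (maxn n k) => //; split.
    - by move: x Fnx; exact/subsetPset/ndF/leq_maxl.
    - by move: y Gky; exact/subsetPset/ndG/leq_maxr.
  by move=> [n _ []/= ? ?]; split; exists n.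
move=> k; have [? ?] := Foo k; have [? ?] := Goo k.
split; first exact: measurableX.
by rewrite product_measure1E// lte_mul_pinfty// ge0_fin_numE.
Qed.

Section LebesgueTuple.
Context {R : realType}.
Local Notation T := (measurableTypeR R).

Definition tuple_cons n (p : T * n.-tuple T) : n.+1.-tuple T :=
  [the n.+1.-tuple T of p.1 :: p.2].

Lemma measurable_tuple_cons n : measurable_fun [set: T * n.-tuple T]
  (@tuple_cons n).
Proof. exact: (measurable_cons measurable_fst measurable_snd). Qed.

Definition tuple_uncons n (t : n.+1.-tuple T) : T * n.-tuple T :=
  (thead t, [tuple of behead t]).

Lemma measurable_tuple_uncons n :
  measurable_fun [set: n.+1.-tuple T] (@tuple_uncons n).
Proof.
apply: measurable_fun_pair; first exact: measurable_tnth.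
exact: measurable_behead.
Qed.

Lemma tuple_consK n : cancel (@tuple_cons n) (@tuple_uncons n).
Proof. by case=> x t; congr (_, _); apply/val_inj. Qed.

Lemma tuple_unconsK n : cancel (@tuple_uncons n) (@tuple_cons n).
Proof. by move=> t; rewrite [RHS]tuple_eta; apply/val_inj. Qed.

Section step.
Variables (n : nat) (mu : {sigma_finite_measure set (n.-tuple T) -> \bar R}).

Definition lebesgue_tuple_step : set (n.+1.-tuple T) -> \bar R :=
  pushforward (@lebesgue_measure R \x mu)%E (@tuple_cons n).

Let step0 : lebesgue_tuple_step set0 = 0%E.
Proof. by rewrite /lebesgue_tuple_step /pushforward preimage_set0 measure0. Qed.

Let step_ge0 A : (0 <= lebesgue_tuple_step A)%E.
Proof. exact: (measure_ge0 (@lebesgue_measure R \x mu)%E). Qed.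

Let step_sigma_additive : semi_sigma_additive lebesgue_tuple_step.
Proof.
exact: (@measure_semi_sigma_additive _ _ _
  (measure_function_pushforward__canonical__measure_function_Measure
    (@lebesgue_measure R \x mu)%E (@measurable_tuple_cons n))).
Qed.

HB.instance Definition _ := isMeasure.Build _ _ _
  lebesgue_tuple_step step0 step_ge0 step_sigma_additive.

Let step_sigma_finite : sigma_finite setT lebesgue_tuple_step.
Proof.
have [F FT mF] := product_sigma_finite (@lebesgue_measure R) mu.
exists (fun i => @tuple_uncons n @^-1` F i).
  by rewrite -preimage_bigcup -FT preimage_setT.
move=> i; have [mFi Foo] := mF i; split.
  by rewrite -[X in measurable X]setTI; exact: measurable_tuple_uncons.
rewrite /lebesgue_tuple_step /pushforward -comp_preimage.
rewrite (_ : @tuple_uncons n \o @tuple_cons n = id) ?preimage_id//.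
by apply/funext => x /=; rewrite tuple_consK.
Qed.

HB.instance Definition _ := Measure_isSigmaFinite.Build _ _ _
  lebesgue_tuple_step step_sigma_finite.

End step.

Fixpoint lebesgue_tuple (n : nat) :
    {sigma_finite_measure set (n.-tuple T) -> \bar R} :=
  match n with
  | 0 => \d_([tuple] : 0.-tuple T)
  | n'.+1 => lebesgue_tuple_step (lebesgue_tuple n')
  end.

End LebesgueTuple.
Arguments lebesgue_tuple R n : clear implicits.

(* R^d with its Borel sigma-algebra. *)
Notation euclidean R d := (g_sigma_algebraType (@open 'rV[R]_d)).

Section Lebesgue.
Context {R : realType}.
Local Notation T := (measurableTypeR R).
Variable d : nat.

Definition row_of_tuple (t : d.-tuple T) : euclidean R d :=
  \row_(i < d) tnth t i.

Lemma measurable_row_of_tuple : measurable_fun [set: d.-tuple T] row_of_tuple.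
Proof.
apply: (@measurability _ _ _ (euclidean R d) _ _ (@open 'rV[R]_d)) => [//|_ [U oU <-]].
rewrite setTI.
pose box (p : 'rV[rat]_d * nat) : set 'rV[R]_d :=
  [set x | forall i, `|ratr (p.1 ord0 i) - x ord0 i| < p.2.+1%:R^-1].
have mbox p : measurable (row_of_tuple @^-1` box p).
  rewrite (_ : _ @^-1` _ = \bigcap_(i in [set: 'I_d])
    ((fun t : d.-tuple T => tnth t i) @^-1`
      ball (ratr (p.1 ord0 i) : R) p.2.+1%:R^-1)).
    apply: fin_bigcap_measurable => // i _.
    rewrite -[X in measurable X]setTI.
    apply: measurable_tnth => //.
    by rewrite ball_itv; exact: measurable_itv.
  apply/seteqP; split=> t /= tb i => [_|]; have := tb i; rewrite mxE//.
  exact.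
suff -> : row_of_tuple @^-1` U =
    \bigcup_(p in [set p | box p `<=` U]) (row_of_tuple @^-1` box p).
  rewrite bigcup_mkcond.
  apply: countable_bigcupT_measurable => [|p]; first exact: countableP.
  by case: ifP.
apply/seteqP; split=> t /=; last by move=> [p /= pU /pU].
set x : 'rV[R]_d := row_of_tuple t => Ux.
have : nbhs x U by exact: open_nbhs_nbhs.
move=> /nbhs_ballP[_ /posnumP[e] /= xeU].
near \oo => n.
have n2e : n.+1%:R^-1 *+ 2 < e%:num :> R.
  rewrite -[X in X < _]mulr_natr -ltr_pdivlMr//.
  by near: n; exact: (near_infty_natSinv_lt (e%:num / 2)%:pos).
have n0 : 0 < n.+1%:R^-1 :> R by rewrite invr_gt0.
have /choice[q qx] : forall i, exists q : rat,
    `|ratr q - x ord0 i| < n.+1%:R^-1 :> R.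
  move=> i; have /rat_in_itvoo[q] : x ord0 i < x ord0 i + n.+1%:R^-1.
    by rewrite ltrDl.
  rewrite in_itv/= => /andP[xq qx]; exists q.
  by rewrite ger0_norm ?subr_ge0 1?ltW// ltrBlDl.
exists (\row_i q i, n) => /=; last by move=> i; rewrite /= mxE; exact: qx.
move=> y /= qy; apply: xeU; split=> // i0 i; rewrite (ord1 i0).
rewrite /ball/= (le_lt_trans _ n2e)// (le_trans (ler_distD (ratr (q i)) _ _))//.
rewrite mulr2n lerD// ltW//; first by rewrite distrC; exact: qx.
by have := qy i; rewrite mxE.
Unshelve. all: by end_near. Qed.

Definition lebesgue : set (euclidean R d) -> \bar R :=
  pushforward (lebesgue_tuple R d) row_of_tuple.

Let lebesgue0 : lebesgue set0 = 0%E.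
Proof. by rewrite /lebesgue /pushforward preimage_set0 measure0. Qed.

Let lebesgue_ge0 A : (0 <= lebesgue A)%E.
Proof. exact: (measure_ge0 (lebesgue_tuple R d)). Qed.

Let lebesgue_sigma_additive : semi_sigma_additive lebesgue.
Proof.
exact: (@measure_semi_sigma_additive _ _ _
  (measure_function_pushforward__canonical__measure_function_Measure
    (lebesgue_tuple R d) measurable_row_of_tuple)).
Qed.

HB.instance Definition _ := isMeasure.Build _ _ _
  lebesgue lebesgue0 lebesgue_ge0 lebesgue_sigma_additive.

End Lebesgue.
Arguments lebesgue R d : clear implicits.

(** * Mass distributions *)

Definition mass_distribution (R : realType) (d : nat)
    (mu : {finite_measure set (euclidean R d) -> \bar R}) : Prop :=
  (exists f : euclidean R d -> R,
    (lebesgue R d).-integrable [set: euclidean R d] (EFin \o f) /\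
    forall A : set (euclidean R d), measurable A ->
      mu A = (\int[lebesgue R d]_(x in A) (f x)%:E)%E) /\
  (forall U : set 'rV[R]_d, open U -> U !=set0 -> (0 < mu U)%E).

(** * Hyperplanes and boxes *)

Definition dot (R : realType) (d : nat) (u v : 'rV[R]_d) : R :=
  \sum_(i < d) u ord0 i * v ord0 i.

(* The affine hyperplane of the points x such that dot normal x = offset. *)
Record hyperplane (R : realType) (d : nat) := Hyperplane {
  normal : 'rV[R]_d;
  offset : R;
  normal_neq0 : normal != 0 }.

Definition parallel (R : realType) (d : nat) (H K : hyperplane R d) : Prop :=
  exists c : R, normal K = c *: normal H.

(* Closed half-spaces; a mass distribution does not charge hyperplanes, so
   that open half-spaces would give boxes of the same measure. *)
Definition half_space (R : realType) (d : nat) (H : hyperplane R d)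
    (s : bool) : set 'rV[R]_d :=
  [set x | if s then offset H <= dot (normal H) x
           else dot (normal H) x <= offset H].

(* Any set of l distinct parallel hyperplanes can be described with a common
   normal vector and enumerated by increasing offset. *)
Definition parallel_collection (R : realType) (d l : nat)
    (G : 'I_l -> hyperplane R d) : Prop :=
  (forall i j : 'I_l, normal (G i) = normal (G j)) /\
  (forall i j : 'I_l, (i < j)%N -> offset (G i) < offset (G j)).

(* The i-th region lies between the hyperplanes number i-1 and i. *)
Definition region (R : realType) (d l : nat) (G : 'I_l -> hyperplane R d)
    (i : 'I_l.+1) : set 'rV[R]_d :=
  \bigcap_(j in [set: 'I_l]) half_space (G j) (j < i)%N.

Definition non_parallel_to (R : realType) (d l n : nat)
    (G : 'I_l -> hyperplane R d) (H : 'I_n -> hyperplane R d) : Prop :=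
  (forall i j, ~ parallel (G i) (H j)) /\
  (forall i j, i != j -> ~ parallel (H i) (H j)).

Definition box (R : realType) (d l n : nat) (G : 'I_l -> hyperplane R d)
    (H : 'I_n -> hyperplane R d) (i : 'I_l.+1) (s : {ffun 'I_n -> bool}) :
    set 'rV[R]_d :=
  region G i `&` \bigcap_(j in [set: 'I_n]) half_space (H j) (s j).

Definition equipartition (R : realType) (d l n : nat)
    (mu : set (euclidean R d) -> \bar R)
    (G : 'I_l -> hyperplane R d) (H : 'I_n -> hyperplane R d) : Prop :=
  forall (i : 'I_l.+1) (s : {ffun 'I_n -> bool}),
    mu (box G H i s) = (((l.+1 * 2 ^ n)%N%:R^-1)%:E * mu setT)%E.

(* Main.v *)
(* Given m nonzero normal vectors, cut the mass into 2k + 2 equal slabs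
   orthogonal to the first one, and in halves by a hyperplane orthogonal to each
   of the others.  Pairing the i-th slab with the i-th slab from the other end,
   reversal of a normal vector permutes the boxes of a pair like a translation
   of (Z/2)^m, so that the Fourier coefficients of the masses of the boxes are
   equivariant functions f_j on (S^(d-1))^m with values in characters of
   (Z/2)^m, that is, in linear forms l_j over Z/2.  The coefficients that do not
   vanish for trivial reasons correspond to the linear factors of q, since the
   Dickson polynomial is the product of all nonzero linear forms; a common zero
   of the f_j is an equipartition, and non-parallelism is then automatic, as
   no box is null.

   Common zeros come from the following Borsuk-Ulam theorem: they exist as soon
   as the product of the l_j has a nonzero coefficient at some x^a with all
   a_i < d.  Triangulate the product of the spheres S^(a_i) by a grid in
   spherical coordinates, and let s_j be the sign of f_j at the vertices of the
   grid.  The cup product of the coboundaries of the s_j, summed over a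
   fundamental domain, is computed by Stokes' theorem: the boundary faces are
   degenerate or identified in pairs by antipodal maps, and the resulting
   recursion is the one satisfied by the coefficient of x^a in the product of
   the l_j.  Hence the cup product is not identically zero, and on some cell all
   the f_j change sign; refine the grid and use compactness. *)

Require Import Defs.
From mathcomp Require Import all_boot all_order all_algebra.
From mathcomp Require mpoly.
Import -(notations) mpoly.
From mathcomp Require Import all_classical all_reals all_analysis.
From mathcomp Require Import ring lra zify.

Set Implicit Arguments.
Unset Strict Implicit.
Unset Printing Implicit Defensive.

Import Order.TTheory GRing.Theory Num.Theory.
Import numFieldNormedType.Exports.

Local Open Scope classical_set_scope.
Local Open Scope ring_scope.

(** * Cochains on a cubical grid *)

Lemma addF2 (x : 'F_2) : x + x = 0.
Proof. exact: (addrr_pchar2 (pchar_Fp (isT : prime 2))). Qed.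

(** Off-diagonal terms cancel in pairs in characteristic 2; this makes the boundary of a boundary
    vanish below. *)
Lemma sum_sym_F2 (J : Type) (r : seq J) (T : J -> J -> 'F_2) :
  (forall x y, T x y = T y x) -> (forall x, T x x = 0) ->
  \sum_(x <- r) \sum_(y <- r) T x y = 0.
Proof.
move=> Tsym T0; elim: r => [|x r IH]; first by rewrite big_nil.
rewrite big_cons big_cons T0 add0r.
under [X in _ + X]eq_bigr do rewrite big_cons.
rewrite big_split /= IH addr0.
under [X in _ + X]eq_bigr do rewrite Tsym.
exact: addF2.
Qed.

Section Grid.
Variable I : finType.
Implicit Types (u v c : I -> int) (r q : I) (D : {set I}) (L : seq I).

Definition upd u r (x : int) : I -> int := fun q => if q == r then x else u q.

(** Cells have even vertices, so that integer points are centres of faces; a step from an odd to an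
    even coordinate leads to a facet, downwards if [e] is true. *)
Definition step u r (e : bool) := upd u r (u r + (-1) ^+ e).

Lemma upd_comm u r q x y : r != q -> upd (upd u r x) q y = upd (upd u q y) r x.
Proof.
move=> rq; apply/funext => p; rewrite /upd.
by case: eqP => // ->; rewrite eq_sym (negbTE rq).
Qed.

Lemma updK u r x y : upd (upd u r x) r y = upd u r y.
Proof. by apply/funext => p; rewrite /upd; case: eqP. Qed.

Lemma updE u r x : upd u r x r = x.
Proof. by rewrite /upd eqxx. Qed.

Lemma updN u r x q : q != r -> upd u r x q = u q.
Proof. by rewrite /upd => /negbTE ->. Qed.

Lemma step_comm u r q e e' : r != q ->
  step (step u r e) q e' = step (step u q e') r e.
Proof.
move=> rq; rewrite /step upd_comm// (updN _ _ rq) updN//.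
by rewrite eq_sym.
Qed.

(* The flags of faces of a cubical cell are the ways to walk from its centre
   [u] by unit steps, one along each direction in [D].  [flagsum u D ss] is the
   value of the cup product of the coboundaries of the cochains [ss] on the sum
   of these flags. *)
Fixpoint flagsum u D (ss : seq ((I -> int) -> 'F_2)) : 'F_2 :=
  if ss is s :: ss' then
    \sum_(r in D) \sum_(e : bool)
      (s u + s (step u r e)) * flagsum (step u r e) (D :\ r) ss'
  else 1.

(** The cup product vanishes on the boundary of a cell. In the first coboundary, the value at the
    centre of a facet factors out and is killed by induction; the other terms are indexed by two
    consecutive steps, whose order can be exchanged. *)
Lemma flagsum_closed ss u D :
  \sum_(r in D) \sum_(e : bool) flagsum (step u r e) (D :\ r) ss = 0.
Proof.
elim: ss u D => [|s ss IH] u D.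
  by rewrite big1// => r _; rewrite big_bool; exact: addF2.
pose T (x y : I * bool) : 'F_2 :=
  if [&& x.1 \in D, y.1 \in D & x.1 != y.1] then
    let v := step (step u x.1 x.2) y.1 y.2 in
    s v * flagsum v (D :\ x.1 :\ y.1) ss else 0.
transitivity (\sum_x \sum_y T x y); last first.
  apply: sum_sym_F2 => [[r e] [q e']|[r e]]; rewrite /T /= ?eqxx ?andbF//.
  rewrite andbCA eq_sym; case: ifP => //= /and3P[_ _ rq].
  by rewrite step_comm 1?eq_sym// finset.setDDl finset.setUC -finset.setDDl.
rewrite -(pair_big xpredT xpredT (fun r e => \sum_y T (r, e) y)) /=.
rewrite big_mkcond; apply: eq_bigr => r _; case: ifP => [rD|rND]; last first.
  by rewrite big1// => e _; rewrite big1// => y _; rewrite /T /= rND.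
apply: eq_bigr => e _ /=.
under eq_bigr => q _ do under eq_bigr => e' _ do rewrite mulrDl.
under eq_bigr => q _ do rewrite big_split /= -mulr_sumr.
rewrite big_split /= -mulr_sumr IH mulr0 add0r.
rewrite -(pair_big xpredT xpredT (fun q e' => T (r, e) (q, e'))) /=.
rewrite big_mkcond; apply: eq_bigr => q _;
  rewrite !inE /T /= rD /= andbC eq_sym.
by case: ifP => // _; rewrite big1.
Qed.

(** With as many cochains as directions, every flag steps once along [a], where the coboundary of a
    cochain independent of that coordinate is zero. The invariant [P] restricts the independence to
    a face. *)
Lemma flagsum_const a ss u D (P : (I -> int) -> Prop) :
  size ss = #|D| -> a \in D ->
  (forall v r e, r \in D -> P v -> P (step v r e)) ->
  (forall s v x, List.In s ss -> P v -> s (upd v a x) = s v) ->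
  P u -> flagsum u D ss = 0.
Proof.
elim: ss u D => [|s ss IH] u D /=.
  by move=> /esym /eqP; rewrite cards_eq0 => /eqP ->; rewrite inE.
move=> sz aD PD sP Pu; rewrite big1// => r rD; rewrite big1// => e _.
have [<-|ra] := eqVneq a r.
  by rewrite [s (step _ _ _)]sP ?addF2 ?mul0r//; left.
rewrite IH ?mulr0// ?inE ?aD ?ra//.
- by move: sz; rewrite (cardsD1 r) rD => -[].
- by move=> v q e'; rewrite !inE => /andP[_]; exact: PD.
- by move=> s' v x ss'; apply: sP; right.
- exact: PD.
Qed.

(** Some flag contributes a nonzero product, so each cochain changes along one of its steps, and the
    whole flag stays close to [u]. *)
Lemma flagsum_nonconst ss u D :
  flagsum u D ss <> 0 -> forall s, List.In s ss ->
  exists v w, [/\ s v != s w,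
    forall q, q \notin D -> v q = u q /\ w q = u q &
    forall q, `|v q - u q| <= 1 /\ `|w q - u q| <= 1].
Proof.
elim: ss u D => [//|s ss IH] u D /= W0 s' s's.
have [r [e [rD]]] : exists r, exists e, r \in D /\
    (s u + s (step u r e)) * flagsum (step u r e) (D :\ r) ss <> 0.
  apply: contrapT => H; apply: W0; rewrite big1// => r rD;
    rewrite big1// => e _.
  by apply: contrapT => H0; apply: H; exists r, e.
move=> /eqP; rewrite mulf_eq0 => /norP[s0 /eqP/IH{}IH].
have dstep q : `|step u r e q - u q| <= 1.
  rewrite /step /upd; case: eqP => [->|_]; last by rewrite subrr normr0.
  by rewrite addrC addKr normrX normrN1 expr1n.
case: s's => [<-|/IH [v [w [vw vwu dvw]]]].
  exists u, (step u r e); split => //.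
  - by apply: contra s0 => /eqP ->; rewrite addF2.
  - move=> q qD; split => //; rewrite /step updN//.
    by apply: contra qD => /eqP ->.
  - by move=> q; rewrite subrr normr0.
exists v, w; split => // q => [qD|].
  have /vwu [-> ->] : q \notin D :\ r by rewrite !inE (negbTE qD) andbF.
  by rewrite /step updN//; apply: contra qD => /eqP ->.
have [->|qr] := eqVneq q r.
  have /vwu [-> ->] : r \notin D :\ r by rewrite !inE eqxx.
  by split; exact: dstep.
by have := dvw q; rewrite /step updN.
Qed.

(** [f] permutes the flags, reversing the directions marked by [b], and adding a constant to a
    cochain does not change its coboundary. *)
Lemma flagsum_symm (f : (I -> int) -> I -> int) (b : I -> bool)
    (P : (I -> int) -> Prop) ss u D :
  (forall v r e, r \in D -> P v -> P (step v r e)) ->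
  (forall v r e, r \in D -> f (step v r e) = step (f v) r (b r (+) e)) ->
  (forall s, List.In s ss -> exists l, forall v, P v -> s (f v) = s v + l) ->
  P u -> flagsum (f u) D ss = flagsum u D ss.
Proof.
elim: ss u D => [//|s ss IH] u D PD fD sP Pu /=.
apply: eq_bigr => r rD; rewrite (reindex_inj (@addbI (b r))) /=.
apply: eq_bigr => e _; rewrite -fD// IH => [||||]; first last.
- exact: PD.
- by move=> s' ss'; apply: sP; right.
- by move=> v q e'; rewrite !inE => /andP[_]; exact: fD.
- by move=> v q e'; rewrite !inE => /andP[_]; exact: PD.
have PDs : P (step u r e) by exact: PD.
have [l sl] : exists l, forall v, P v -> s (f v) = s v + l by apply: sP; left.
by rewrite !sl// addrACA addF2 addr0.
Qed.

Variable n : nat.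

(* Sum over the centres of the cells in [0, 2n]^L, the centre of the interval
   [2k, 2k+2] being 2k+1. *)
Fixpoint cellsum L (G : (I -> int) -> 'F_2) u : 'F_2 :=
  if L is r :: L' then \sum_(k < n) cellsum L' G (upd u r (k.*2.+1)%:Z)
  else G u.

Lemma cellsum_ext L G G' u :
  (forall v, (forall q, q \notin L -> v q = u q) -> G v = G' v) ->
  cellsum L G u = cellsum L G' u.
Proof.
elim: L u => [|r L IH] u GG' /=; first by apply: GG'.
apply: eq_bigr => k _; apply: IH => v vu; apply: GG' => q.
by rewrite inE => /norP[qr /vu ->]; rewrite updN.
Qed.

Lemma cellsum_agree L G u v : (forall q, q \notin L -> u q = v q) ->
  cellsum L G u = cellsum L G v.
Proof.
elim: L u v => [|r L IH] u v uv /=.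
  by congr G; apply/funext => q; exact: uv.
apply: eq_bigr => k _; apply: IH => q qL; rewrite /upd; case: eqP => // /eqP qr.
by apply: uv; rewrite inE negb_or qr.
Qed.

Lemma cellsumD L G G' u :
  cellsum L (fun v => G v + G' v) u = cellsum L G u + cellsum L G' u.
Proof.
by elim: L u => [//|r L IH] u /=; rewrite -big_split; apply: eq_bigr.
Qed.

Lemma cellsumZ L a G u : cellsum L (fun v => a * G v) u = a * cellsum L G u.
Proof.
by elim: L u => [//|r L IH] u /=; rewrite mulr_sumr; apply: eq_bigr.
Qed.

Lemma cellsum_sum J (s : seq J) (Q : pred J) L (G : J -> (I -> int) -> 'F_2) u :
  cellsum L (fun v => \sum_(j <- s | Q j) G j v) u
  = \sum_(j <- s | Q j) cellsum L (G j) u.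
Proof.
elim: L u => [//|r L IH] u /=; rewrite exchange_big /=.
by apply: eq_bigr.
Qed.

Lemma cellsum_upd L G u r x : r \notin L ->
  cellsum L G (upd u r x) = cellsum L (fun v => G (upd v r x)) u.
Proof.
elim: L u => [//|q L IH] u /=; rewrite inE => /norP[rq rL].
by apply: eq_bigr => k _; rewrite upd_comm// IH.
Qed.

Lemma cellsum_rem L G u r : uniq L -> r \in L ->
  cellsum L G u = \sum_(k < n) cellsum (rem r L) G (upd u r (k.*2.+1)%:Z).
Proof.
elim: L u => [//|q L IH] u /= /andP[qL uL]; rewrite inE eq_sym.
have [<-//|qr /= rL] := eqVneq q r.
under eq_bigr => k _ do rewrite IH//.
rewrite exchange_big; apply: eq_bigr => k _; apply: eq_bigr => k' _ /=.
by rewrite upd_comm.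
Qed.

Lemma telescope_F2 (h : int -> 'F_2) :
  \sum_(k < n) (h k.*2.+2%:Z + h k.*2%:Z) = h 0 + h n.*2%:Z.
Proof.
elim: n => [|k IH]; first by rewrite big_ord0 addF2.
by rewrite big_ord_recr /= IH doubleS -addrA [X in _ + X]addrCA addF2 addr0.
Qed.

(** By [flagsum_closed], only the values of [s] at the centres of facets survive. A facet shared by
    two neighbouring cells counts twice, so the sum telescopes to the outer faces. *)
Lemma stokes L D s ss u : uniq L -> D =i L ->
  cellsum L (fun c => flagsum c D (s :: ss)) u =
  \sum_(r in D) cellsum (rem r L) (fun c =>
    s (upd c r 0) * flagsum (upd c r 0) (D :\ r) ss +
    s (upd c r n.*2%:Z) * flagsum (upd c r n.*2%:Z) (D :\ r) ss) u.
Proof.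
move=> uL DL; pose g r v := s v * flagsum v (D :\ r) ss.
transitivity (cellsum L (fun c =>
    \sum_(r in D) (g r (step c r false) + g r (step c r true))) u).
  apply: cellsum_ext => c _ /=.
  under eq_bigr => r _ do under eq_bigr => e _ do rewrite mulrDl.
  under eq_bigr => r _ do rewrite big_split /= -mulr_sumr.
  rewrite big_split /= -mulr_sumr flagsum_closed mulr0 add0r.
  by apply: eq_bigr => r _; rewrite big_bool addrC.
rewrite cellsum_sum; apply: eq_bigr => r; rewrite DL => rL.
have rr : r \notin rem r L by rewrite mem_rem_uniq// inE eqxx.
rewrite (@cellsum_rem L _ u r uL rL).
under eq_bigr => k _ do rewrite cellsum_upd//.
rewrite -cellsum_sum; apply: cellsum_ext => c _.
rewrite -(telescope_F2 (fun x => g r (upd c r x))).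
apply: eq_bigr => k _; rewrite /step !updK !updE /= expr0 expr1.
by congr (g _ (upd _ _ _) + g _ (upd _ _ _)); lia.
Qed.

(** The reversal of a coordinate sends the centre 2k + 1 to 2(n - 1 - k) + 1 and thus permutes the
    cells. *)
Lemma cellsum_symm L G u (f : (I -> int) -> I -> int) (b : I -> bool) :
  (forall v r x, r \in L ->
    f (upd v r x) = upd (f v) r (if b r then n.*2%:Z - x else x)) ->
  cellsum L (G \o f) u = cellsum L G (f u).
Proof.
elim: L u => [//|r L IH] u fL /=.
have fL' v q x : q \in L ->
    f (upd v q x) = upd (f v) q (if b q then n.*2%:Z - x else x).
  by move=> qL; apply: fL; rewrite inE qL orbT.
under eq_bigr => k _ do rewrite (IH _ fL') fL ?mem_head//.
case: (b r) => //; rewrite (reindex_inj rev_ord_inj).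
apply: eq_bigr => k _; congr (cellsum _ _ (upd _ _ _)).
by rewrite /=; have := ltn_ord k; lia.
Qed.

Lemma cellsum_neq0 L G u : cellsum L G u <> 0 ->
  exists c, [/\ G c <> 0, forall q, q \notin L -> c q = u q &
    forall q, q \in L -> 0 <= c q <= n.*2%:Z].
Proof.
elim: L u => [|r L IH] u /= Gu; first by exists u.
have [k] : exists k : 'I_n, cellsum L G (upd u r (k.*2.+1)%:Z) <> 0.
  apply: contrapT => H; apply: Gu; rewrite big1// => k _.
  by apply: contrapT => H0; apply: H; exists k.
move=> /IH[c [Gc cN cL]]; exists c; split => // q.
  by rewrite inE => /norP[qr /cN ->]; rewrite updN.
rewrite inE; have [qL _|qL] := boolP (q \in L); first exact: cL.
rewrite orbF => /eqP qr; rewrite cN// qr updE.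
have := ltn_ord k; lia.
Qed.

End Grid.

(** * Cup products on a product of spheres *)

Notation linear_form l := (\sum_i l i *: mvar i).

(** This is the recursion that Stokes' theorem reproduces for cup products. The test [0 < a i]
    guards the truncated subtraction of exponents. *)
Lemma mcoeff_linear_form m (l : 'I_m -> 'F_2) (p : mpoly m 'F_2) a :
  mcoeff a (linear_form l * p) =
  \sum_i if (0 < a i)%N then l i * mcoeff (mnm_sub a (mnm1 i)) p else 0.
Proof.
rewrite mulr_suml raddf_sum; apply: eq_bigr => i _ /=.
rewrite -scalerAl mcoeffZ mulrC [_ * p]mulrC lt0n -lep1mP.
case: ifP => [ai|aiN]; first by rewrite -{1}(submK ai) addmC mcoeffMX mulrC.
suff -> : mcoeff a (p * mvar i) = 0 by rewrite mul0r.
apply/eqP; rewrite mcoeff_eq0 (perm_mem (msuppMX _ _)).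
apply/mapP => -[b _ ab]; move: aiN; rewrite ab lep1mP mnmDE mnm1E eqxx.
by [].
Qed.

Section SphereCup.
Variables (m d n : nat).
Notation coord := ('I_m * 'I_d)%type.
Implicit Types (u v c : coord -> int) (a : multinom m).

(* A point [u] stands for the point of (S^(d-1))^m with spherical coordinates
   pi u / (2n).  On the face where the [r]-th coordinate of the [i]-th sphere
   vanishes, [reflect i r] is the antipodal map of that sphere, landing in the
   opposite face. *)
Definition reflect (i : 'I_m) (r : 'I_d) u : coord -> int := fun q =>
  if q.1 == i then if (q.2 < r)%N then n.*2%:Z - u q
                   else if q.2 == r then n.*2%:Z else u q
  else u q.

(** Expresses that [s] depends on the point only: once an angle is 0 or pi, its sine vanishes and
    the later angles of that sphere do not matter. *)
Definition spherical (s : (coord -> int) -> 'F_2) : Prop :=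
  forall u i (r q : 'I_d) x, (r < q)%N -> u (i, r) = 0 \/ u (i, r) = n.*2%:Z ->
  s (upd u (i, q) x) = s u.

(** Required only on the faces where [reflect] is the antipodal map. The sphere S^(d-1) has d - 1
    angles; the last of the [d] coordinates is a dummy, kept at 0. *)
Definition equivariant (s : (coord -> int) -> 'F_2) (l : 'I_m -> 'F_2) : Prop :=
  forall u i (r : 'I_d), (r.+1 < d)%N -> u (i, r) = 0 ->
  (forall q : coord, q.2.+1 = d -> u q = 0) -> s (reflect i r u) = s u + l i.

(** The free angles. With the others at 0 they parametrize a closed half of each S^(a_i), a
    fundamental domain of the antipodal map. *)
Definition expset a : {set coord} := [set p : coord | (p.2 < a p.1)%N].

Lemma reflect_upd i r v q x : q != (i, r) ->
  reflect i r (upd v q x) =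
  upd (reflect i r v) q (if (q.1 == i) && (q.2 < r)%N then n.*2%:Z - x else x).
Proof.
move=> qir; apply/funext => p; rewrite /reflect /upd.
have [->|] := eqVneq p q; last by [].
case: eqP => //= q1; rewrite -val_eqE /=; case: ltngtP => //= /val_inj q2.
by move: qir; rewrite -q1 -q2 -surjective_pairing eqxx.
Qed.

Lemma reflect_step i r v q e : q != (i, r) ->
  reflect i r (step v q e) =
  step (reflect i r v) q (((q.1 == i) && (q.2 < r)%N) (+) e).
Proof.
move=> qir; rewrite /step reflect_upd//; congr upd; rewrite /reflect.
have [q1|] //= := eqVneq q.1 i.
have [q2|] /= := ltnP q.2 r; first by rewrite signrN opprD addrA.
case: eqP => // q2.
by move: qir; rewrite -q1 -q2 -surjective_pairing eqxx.
Qed.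

Section term.
Variables (a : multinom m) (L : seq coord) (i : 'I_m) (r : 'I_d).
Variables (s : (coord -> int) -> 'F_2) (ss : seq ((coord -> int) -> 'F_2)).
Hypotheses (uL : uniq L) (DL : expset a =i L) (ad : forall j, (a j < d)%N).
Hypotheses (rD : (i, r) \in expset a) (sz : mdeg a = (size ss).+1).

Let D' := expset a :\ (i, r).
Let g v := s v * flagsum v D' ss.

Lemma card_expset : #|expset a| = mdeg a.
Proof.
rewrite -sum1_card mdegE.
transitivity (\sum_(p : coord | xpredT p.1 && (p.2 < a p.1)%N) 1)%N.
  by apply: eq_bigl => p; rewrite inE.
rewrite -(pair_big_dep xpredT (fun j (q : 'I_d) => (q < a j)%N)
  (fun _ _ => 1%N)) /=.
apply: eq_bigr => j _.
rewrite -(big_ord_widen _ (fun=> 1%N) (ltnW (ad j))) sum_nat_const card_ord.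
by rewrite muln1.
Qed.

(** At a pole of an earlier angle, no cochain depends on the last free angle of the sphere: the face
    is degenerate. *)
Lemma inner_face_term u x : (r.+1 < a i)%N -> x = 0 \/ x = n.*2%:Z ->
  (forall t, List.In t ss -> spherical t) ->
  flagsum (upd u (i, r) x) D' ss = 0.
Proof.
clear L uL DL.
move=> ra x02 sph; have q0d : ((a i).-1 < d)%N
  by rewrite (leq_ltn_trans (leq_pred _)).
apply: (@flagsum_const _ (i, Ordinal q0d) _ _ _
  (fun v => v (i, r) = 0 \/ v (i, r) = n.*2%:Z)).
- by have := card_expset; rewrite sz (cardsD1 (i, r) (expset a)) rD add1n =>
  -[].
- by rewrite !inE /= xpair_eqE eqxx /= -val_eqE /=; lia.
- by move=> v q e; rewrite !inE => /andP[qr _]; rewrite /step updN 1?eq_sym.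
- move=> t v y tss v02; apply: sph v02 => //=; lia.
- by rewrite updE.
Qed.

(** [reflect] carries the face at angle 0 onto the face at angle pi. It changes [s] by [l i] and
    preserves the rest of the cup product, so the two faces together leave the factor [l i]. *)
Lemma outer_face_term (l : 'I_m -> 'F_2) : (r.+1 = a i)%N ->
  equivariant s l ->
  (forall t, List.In t ss -> exists l', equivariant t l') ->
  cellsum n (rem (i, r) L) (fun c => g (upd c (i, r) 0) +
    g (upd c (i, r) n.*2%:Z)) (fun=> 0) =
  l i * cellsum n (rem (i, r) L) (fun c => flagsum c D' ss) (fun=> 0).
Proof.
move=> ra eqs eqss.
have pN : (i, r) \notin rem (i, r) L by rewrite mem_rem_uniq// inE eqxx.
have remL q : (q \in rem (i, r) L) = (q \in D').
  by rewrite mem_rem_uniq// inE !inE -DL inE.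
rewrite cellsumD -!(@cellsum_upd _ n _ g)//.
have -> : upd (fun=> 0) (i, r) 0 = (fun=> 0) :> (coord -> int).
  by apply/funext => q; rewrite /upd; case: eqP.
(* The two base points differ only in coordinates that are summed over. *)
rewrite (@cellsum_agree _ n _ g (upd _ _ _) (reflect i r (fun=> 0)));
  last first.
  move=> q; rewrite remL !inE negb_and negbK /upd /reflect.
  have [->|qr /= qa] := eqVneq q (i, r); first by rewrite /= eqxx ltnn eqxx.
  case: eqP => // q1; case: ifP => [|_]; first by move: qa; rewrite q1; lia.
  case: eqP => // q2.
  by move: qr; rewrite -q1 -q2 -surjective_pairing eqxx.
rewrite -(@cellsum_symm _ n _ _ _ _ (fun q : coord =>
  (q.1 == i) && (q.2 < r)%N)); last first.
  by move=> v q x; rewrite remL => /setD1P[qr _]; exact: reflect_upd.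
rewrite -cellsumD -cellsumZ; apply: cellsum_ext => v v0.
pose P (w : coord -> int) := w (i, r) = 0 /\
  forall q : coord, q.2.+1 = d -> w q = 0.
have rd : (r.+1 < d)%N by rewrite ra.
have Pv : P v.
  split=> [|q qd]; apply: v0 => //.
  by rewrite remL !inE negb_and -leqNgt; have := ad q.1; lia.
rewrite /g /= (eqs _ _ _ rd Pv.1 Pv.2).
rewrite (@flagsum_symm _ _ (fun q : coord => (q.1 == i) && (q.2 < r)%N) P) //.
- by rewrite mulrDl addrA addF2 add0r.
- move=> w q e /setD1P[qr]; rewrite inE => qa [wi wd]; split.
    by rewrite /step updN// eq_sym.
  move=> p pd; rewrite /step updN ?wd//.
  by apply: contraTneq qa => <-; have := ad p.1; lia.
- by move=> w q e /setD1P[qr _]; exact: reflect_step.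
- move=> t /eqss[l' eqt]; exists (l' i) => w [wi wd]; exact: eqt.
Qed.

End term.

(** Induction on the cochains: Stokes' theorem removes the first one, inner faces are degenerate,
    and the outer faces of the sphere [i] give [l i] times the cup product for [a] lowered by one at
    [i]. *)
Lemma cup_product_coeff
    (ls : seq (((coord -> int) -> 'F_2) * ('I_m -> 'F_2))) a L :
  uniq L -> expset a =i L -> (forall i, (a i < d)%N) -> mdeg a = size ls ->
  (forall t, List.In t ls -> spherical t.1 /\ equivariant t.1 t.2) ->
  cellsum n L (fun c => flagsum c (expset a) (map fst ls)) (fun=> 0) =
  mcoeff a (\prod_(t <- ls) linear_form t.2).
Proof.
elim: ls a L => [|[s l] ls IH] a L uL DL ad /= sz eqls.
  have /eqP a0 : mdeg a == 0%N by rewrite sz.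
  rewrite big_nil mcoeff1 -mdeg_eq0 a0 eqxx.
  have -> : L = [::].
    apply/nilP; rewrite /nilp -(card_uniqP uL) -(eq_card DL).
    by rewrite card_expset// a0.
  by [].
rewrite big_cons mcoeff_linear_form stokes//.
set ss := map fst ls; pose F (p : coord) := cellsum n (rem p L) (fun c =>
  s (upd c p 0) * flagsum (upd c p 0) (expset a :\ p) ss +
  s (upd c p n.*2%:Z) * flagsum (upd c p n.*2%:Z) (expset a :\ p) ss) (fun=> 0).
have ssz : mdeg a = (size ss).+1 by rewrite sz size_map.
have ssE t : List.In t ss -> exists2 t', List.In t' ls & t = t'.1.
  rewrite /ss; elim: (ls) => //= t' ls' IHls [<-|/IHls[t'' ? ?]].
    by exists t' => //; left.
  by exists t'' => //; right.
transitivity (\sum_i \sum_(r < d | (r < a i)%N) F (i, r)).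
  by rewrite pair_big_dep /=; apply: eq_big => -[i r] //; rewrite inE.
apply: eq_bigr => i _; case: ifPn => [ai|]; last first.
  by rewrite -eqn0Ngt => /eqP ->; rewrite big1.
have rd : ((a i).-1 < d)%N by rewrite (leq_ltn_trans (leq_pred _)).
(* The last free angle of the sphere [i]; only its faces contribute. *)
pose r0 := Ordinal rd; have r0a : r0.+1 = a i by rewrite /= prednK.
have r0D : (i, r0) \in expset a by rewrite inE /= -r0a.
rewrite (bigD1 r0) /=; last by rewrite prednK.
rewrite [X in _ + X]big1 ?addr0; last first.
  move=> r /andP[ra rr0]; rewrite /F.
  have ra1 : (r.+1 < a i)%N by move: rr0; rewrite -val_eqE /=; lia.
  have rD : (i, r) \in expset a by rewrite inE.
  have sph t : List.In t ss -> spherical t.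
    by move=> /ssE[t' t'ls ->]; have [] := eqls t' (or_intror t'ls).
  rewrite (@cellsum_ext _ n _ _ (fun=> 0 * 0)) ?cellsumZ ?mul0r// => v _.
  by rewrite !(inner_face_term ad rD ssz)//; [rewrite !mulr0 addr0|right|left].
rewrite /F (outer_face_term uL DL ad r0D ssz r0a (l := l)); first last.
- by move=> t /ssE[t' t'ls ->]; exists t'.2;
  have [] := eqls t' (or_intror t'ls).
- by have [] := eqls (s, l) (or_introl erefl).
have D'E : expset a :\ (i, r0) = expset (mnm_sub a (mnm1 i)).
  apply/setP => -[j q]; rewrite !inE /= mnmBE mnm1E xpair_eqE -[q == r0]val_eqE
    /=.
  by rewrite (eq_sym i j); have [->|_] := eqVneq j i; lia.
rewrite D'E (IH (mnm_sub a (mnm1 i)))//.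
- by rewrite rem_uniq.
- by move=> q; rewrite -D'E mem_rem_uniq// !inE -DL inE.
- by move=> j; rewrite mnmBE (leq_ltn_trans (leq_subr _ _)).
- have : mdeg a = mdeg (mnm_add (mnm_sub a (mnm1 i)) (mnm1 i)).
    by rewrite submK// lep1mP -lt0n.
  by rewrite mdegD mdeg1 sz addn1 => -[].
- by move=> t tls; apply: eqls; right.
Qed.

End SphereCup.

(** * The Dickson polynomial as a product of linear forms *)

Definition ffun_cons n (b : bool) (c : {ffun 'I_n -> bool}) :
    {ffun 'I_n.+1 -> bool} :=
  [ffun i => if unlift ord0 i is Some j then c j else b].

Definition ffun_tail n (c : {ffun 'I_n.+1 -> bool}) : {ffun 'I_n -> bool} :=
  [ffun i => c (lift ord0 i)].

Lemma ffun_cons0 n b (c : {ffun 'I_n -> bool}) : ffun_cons b c ord0 = b.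
Proof. by rewrite ffunE unlift_none. Qed.

Lemma ffun_tail_cons n b (c : {ffun 'I_n -> bool}) :
  ffun_tail (ffun_cons b c) = c.
Proof. by apply/ffunP => i; rewrite !ffunE liftK. Qed.

Lemma ffun_cons_bij n :
  bijective (fun p : bool * {ffun 'I_n -> bool} => ffun_cons p.1 p.2).
Proof.
exists (fun c : {ffun 'I_n.+1 -> bool} => (c ord0, ffun_tail c)).
  by case=> b c; rewrite /= ffun_cons0 ffun_tail_cons.
by move=> c; apply/ffunP => i; rewrite !ffunE; case: unliftP => [j|] ->;
  rewrite ?ffunE.
Qed.

Lemma ffun_cons_eq0 n b (c : {ffun 'I_n -> bool}) :
  (ffun_cons b c == [ffun=> false]) = ~~ b && (c == [ffun=> false]).
Proof.
apply/eqP/andP => [/ffunP bc|[/negbTE -> /eqP ->]].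
  split; first by have := bc ord0; rewrite !ffunE unlift_none => ->.
  by apply/eqP/ffunP => i; have := bc (lift ord0 i); rewrite !ffunE liftK.
by apply/ffunP => i; rewrite !ffunE; case: unliftP => // j _; rewrite ffunE.
Qed.

(** * Moore determinants in characteristic 2 *)

Section Moore.
Variable A : idomainType.
Hypothesis A2 : 2%N \in [pchar A].

Definition subsum n (c : {ffun 'I_n -> bool}) (y : 'I_n -> A) : A :=
  \sum_(i | c i) y i.

Definition moore n (y : 'I_n -> A) : A := \det (\matrix_(i, j) y i ^+ (2 ^ j)).

Lemma subsum_cons n b (c : {ffun 'I_n -> bool}) (y : 'I_n.+1 -> A) :
  subsum (ffun_cons b c) y =
  (if b then y ord0 else 0) + subsum c (fun i => y (lift ord0 i)).
Proof.
rewrite /subsum big_mkcond big_ord_recl /= ffunE unlift_none; congr (_ + _).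
by rewrite [RHS]big_mkcond; apply: eq_bigr => i _; rewrite ffunE liftK.
Qed.

Lemma big_ffun_cons n (F : {ffun 'I_n.+1 -> bool} -> A) :
  \prod_(c | c != [ffun=> false]) F c =
  (\prod_c F (ffun_cons true c)) *
  \prod_(c | c != [ffun=> false]) F (ffun_cons false c).
Proof.
pose f (p : bool * {ffun 'I_n -> bool}) := ffun_cons p.1 p.2.
rewrite (reindex f) /=; last exact/onW_bij/ffun_cons_bij.
transitivity (\prod_(p : bool * _ | xpredT p.1 && (f p != [ffun=> false]))
  F (f p)).
  by [].
rewrite -(pair_big_dep xpredT (fun b c => f (b, c) != [ffun=> false])
  (fun b c => F (f (b, c)))) /= big_bool /=.
by congr (_ * _); apply: eq_bigl => c; rewrite /f /= ffun_cons_eq0.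
Qed.

Lemma expr_sum_F2 j (I : finType) (P : pred I) (y : I -> A) :
  (\sum_(i | P i) y i) ^+ (2 ^ j) = \sum_(i | P i) y i ^+ (2 ^ j).
Proof.
have ch : ([pchar A]).-nat (2 ^ j)%N by rewrite pnatX pnatE// A2.
apply: (big_morph (fun x => x ^+ (2 ^ j))); last by rewrite expr0n expn_eq0.
by move=> u v; exact: exprDn_pchar.
Qed.

(* As a polynomial in [y ord0] the determinant has degree at most [2 ^ n], and
   it vanishes at the [2 ^ n] sums of the other entries. *)
Lemma moore_recl n (y : 'I_n.+1 -> A) (y' := fun i => y (lift ord0 i)) :
  injective (fun c => subsum c y') ->
  moore y = moore y' * \prod_c (y ord0 + subsum c y').
Proof.
move=> inj; have oppA x : - x = x :> A by exact: oppr_pchar2.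
pose M z : 'M[A]_n.+1 :=
  \matrix_(i, j) (if unlift ord0 i is Some k then y' k else z) ^+ (2 ^ j).
pose a j := cofactor (M 0) ord0 j.
have ME z : \det (M z) = \sum_j a j * z ^+ (2 ^ j).
  rewrite (expand_det_row _ ord0); apply: eq_bigr => j _.
  rewrite mxE unlift_none mulrC /a /cofactor; congr (_ * \det _ * _).
  by apply/matrixP => i k; rewrite !mxE liftK.
have am : a ord_max = moore y'.
  rewrite /a /cofactor add0n.
  have -> : (-1) ^+ n = 1 :> A by rewrite oppA expr1n.
  rewrite mul1r; congr (\det _); apply/matrixP => i j; rewrite !mxE liftK.
  by rewrite lift_max.
have Mroot c : \det (M (subsum c y')) = 0.
  (* Raising to the power 2^j is additive, so the top row is the sum of the rows selected by [c],
     which gives a kernel vector. *)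
  apply/eqP/det0P; exists (\row_i if unlift ord0 i is Some k then (c k)%:R else
    1).
    by apply/eqP => /rowP /(_ ord0) /eqP; rewrite !mxE unlift_none oner_eq0.
  apply/rowP => j; rewrite !mxE big_ord_recl !mxE unlift_none mul1r.
  rewrite expr_sum_F2 big_mkcond -big_split /= big1// => i _.
  rewrite !mxE liftK; case: (c i); rewrite ?mul0r ?addr0// mul1r.
  exact: addrr_pchar2.
pose P : {poly A} := \sum_j a j *: 'X^(2 ^ j).
have PE z : P.[z] = \det (M z).
  rewrite ME horner_sum; apply: eq_bigr => j _.
  by rewrite hornerZ hornerXn.
pose Q : {poly A} := \prod_c ('X - (subsum c y')%:P).
have szQ : size Q = (2 ^ n).+1.
  by rewrite size_prod_XsubC /index_enum -enumT -cardE card_ffun card_bool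
    card_ord.
(* The leading terms cancel, so the difference has degree below 2^n, yet it has 2^n distinct
   roots. *)
have PQ : P - a ord_max *: Q = 0.
  apply/eqP; apply: contraTT isT => PQ0.
  have := max_poly_roots PQ0 (rs := [seq subsum c y' | c <- enum {ffun 'I_n ->
    bool}]).
  rewrite size_map -cardE card_ffun card_bool card_ord.
  move=> /(_ _ _)/wrap[||].
  - apply/allP => _ /mapP[c _ ->]; rewrite rootE hornerD hornerN hornerZ PE
    Mroot.
    rewrite horner_prod (bigD1 c)//= hornerXsubC subrr mul0r mulr0 subr0//.
  - by rewrite map_inj_uniq ?enum_uniq.
  rewrite ltnNge => /negP[]; apply/leq_sizeP => j jn.
  rewrite coefB coefZ; move: jn; rewrite leq_eqVlt => /predU1P[<-|jn].
    have Qm : Q \is monic by rewrite monic_prod_XsubC.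
    have -> : Q`_(2 ^ n) = 1 by rewrite -(monicP Qm) lead_coefE szQ.
    rewrite mulr1 coef_sum (bigD1 ord_max)//= big1 ?addr0.
      by rewrite coefZ coefXn eqxx mulr1 subrr.
    move=> i im; rewrite coefZ coefXn eqn_exp2l//; case: eqP => [ni|];
      last by rewrite mulr0.
    by case/eqP: im; apply/val_inj.
  rewrite [Q`_j]nth_default ?szQ// mulr0 subr0 coef_sum big1// => i _.
  rewrite coefZ coefXn; case: eqP => [ji|]; last by rewrite mulr0.
  by move: jn; rewrite ji ltn_exp2l// ltnNge -ltnS ltn_ord.
have -> : moore y = \det (M (y ord0)).
  congr (\det _); apply/matrixP => i j; rewrite !mxE.
  by case: unliftP => [k ->|->].
rewrite -PE -[P](subrK (a ord_max *: Q)) PQ add0r hornerZ am horner_prod.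
by congr (_ * _); apply: eq_bigr => c _; rewrite hornerXsubC oppA.
Qed.

(** The sums that involve the first entry are the factors in [moore_recl]; the others come from the
    induction. *)
Lemma mooreE n (y : 'I_n -> A) : injective (fun c => subsum c y) ->
  moore y = \prod_(c | c != [ffun=> false]) subsum c y.
Proof.
elim: n y => [|n IH] y inj.
  rewrite /moore det_mx00 big1// => c /eqP[]; apply/ffunP => -[]//.
pose y' i := y (lift ord0 i).
have inj' : injective (fun c => subsum c y').
  move=> c c' cc'; have : ffun_cons false c = ffun_cons false c'.
    by apply: inj; rewrite /= !subsum_cons cc'.
  move=> /ffunP e; apply/ffunP => i; have := e (lift ord0 i).
  by rewrite !ffunE liftK.
rewrite moore_recl// IH// big_ffun_cons mulrC; congr (_ * _).
  by apply: eq_bigr => c _; rewrite subsum_cons.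
by apply: eq_bigr => c _; rewrite subsum_cons add0r.
Qed.

End Moore.

Section DicksonProduct.
Variable m : nat.
Notation X := (fun i : 'I_m => mvar i).

Definition boolform (c : {ffun 'I_m -> bool}) (i : 'I_m) : 'F_2 := (c i)%:R.

Lemma subsum_mvar (c : {ffun 'I_m -> bool}) :
  subsum c X = linear_form (boolform c).
Proof.
rewrite /subsum big_mkcond; apply: eq_bigr => i _; rewrite /boolform.
by case: (c i); rewrite ?scale1r ?scale0r.
Qed.

Lemma mcoeff_mnm1_linear_form (l : 'I_m -> 'F_2) j :
  mcoeff (mnm1 j) (linear_form l) = l j.
Proof.
rewrite raddf_sum /= (bigD1 j)//= big1 => [|i ij]; rewrite mcoeffZ mcoeffXU.
  by rewrite eqxx mulr1 addr0.
by rewrite (negbTE ij) mulr0.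
Qed.

Lemma subsum_mvar_inj : injective (fun c : {ffun 'I_m -> bool} => subsum c X).
Proof.
move=> c c' cc'; apply/ffunP => j.
have : mcoeff (mnm1 j) (subsum c X) = mcoeff (mnm1 j) (subsum c' X)
  by rewrite cc'.
rewrite !subsum_mvar !mcoeff_mnm1_linear_form /boolform.
by case: (c j); case: (c' j).
Qed.

Lemma dicksonE : dickson m =
  \prod_(c : {ffun 'I_m -> bool} | c != [ffun=> false])
    linear_form (boolform c).
Proof.
have A2 : 2%N \in [pchar (mpoly m 'F_2)].
  exact: (rmorph_pchar (@mpolyC m 'F_2) (pchar_Fp (isT : prime 2))).
rewrite -[LHS]/(moore X) (mooreE A2 subsum_mvar_inj).
by apply: eq_bigr => c _; exact: subsum_mvar.
Qed.

Definition unitform (i : 'I_m) : {ffun 'I_m -> bool} := [ffun j => i == j].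

Lemma linear_form_unit i : linear_form (boolform (unitform i)) = mvar i.
Proof.
rewrite (bigD1 i)//= big1 ?addr0 => [|j ji];
  rewrite /boolform ffunE ?eqxx ?scale1r//.
by rewrite eq_sym (negbTE ji) scale0r.
Qed.

Lemma unitform_inj : injective unitform.
Proof. by move=> i j /ffunP /(_ j); rewrite !ffunE eqxx => /eqP. Qed.

Lemma unitform_neq0 i : unitform i != [ffun=> false].
Proof. by apply/eqP => /ffunP /(_ i); rewrite !ffunE eqxx. Qed.

(* These pairs index the linear factors of [q]: of the [k + 1] copies of the forms
   other than [mvar i0], the first one is deprived of the variables. *)
Definition test_form k (i0 : 'I_m) (p : 'I_k.+1 * {ffun 'I_m -> bool}) : bool :=
  [&& p.2 != [ffun=> false], p.2 != unitform i0 &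
      p \notin [set (ord0, unitform i) | i in [pred i | i != i0]]%SET].

(** In a domain, the variable [i0] can be cancelled from each of the [k + 1] copies of the Dickson
    polynomial, then the other variables from the copy [ord0]. *)
Lemma quotient_prod k (i0 : 'I_m) (Q q : mpoly m 'F_2) :
  mvar i0 * Q = dickson m -> (\prod_(i < m | i != i0) mvar i) * q = Q ^+ k.+1 ->
  q = \prod_(p | test_form (k := k) i0 p) linear_form (boolform p.2).
Proof.
have X0 i : mvar i != 0 :> mpoly m 'F_2.
  apply/eqP => /(congr1 (mcoeff (mnm1 i))) /eqP.
  by rewrite mcoeffX eqxx mcoeff0 oner_eq0.
rewrite dicksonE (bigD1 (unitform i0)) ?unitform_neq0//= linear_form_unit.
move=> /(mulfI (X0 i0)) ->.
have -> : forall p : mpoly m 'F_2, p ^+ k.+1 = \prod_(j < k.+1) p.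
  by move=> p; rewrite prodr_const card_ord.
rewrite pair_big_dep /=.
pose E : {set 'I_k.+1 * {ffun 'I_m -> bool}} :=
  [set (ord0, unitform i) | i in [pred i | i != i0]]%SET.
rewrite (bigID (mem E)) /=.
have -> : \prod_(p : 'I_k.+1 * {ffun 'I_m -> bool} |
    (p.2 != [ffun=> false]) && (p.2 != unitform i0) && (p \in E))
    linear_form (boolform p.2) = \prod_(i < m | i != i0) mvar i.
  transitivity (\prod_(p in E) linear_form (boolform p.2)).
    apply: eq_bigl => p; apply: andb_idl => /imsetP[i].
    rewrite inE => ii0 -> /=; rewrite unitform_neq0 /=.
    by apply: contra ii0 => /eqP /unitform_inj ->.
  rewrite big_imset /= => [|i j _ _ [] /unitform_inj//].
  by apply: eq_bigr => i _; exact: linear_form_unit.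
have P0 : \prod_(i < m | i != i0) mvar i != 0 :> mpoly m 'F_2.
  by apply/prodf_neq0.
move=> /(mulfI P0) ->; apply: eq_bigl => p.
by rewrite /test_form andbA.
Qed.

(** If every monomial of [q] had an exponent at least [d], choosing such a variable for each
    monomial would distribute [q] over the generators. *)
Lemma not_ideal_mcoeff d (q : mpoly m 'F_2) :
  ~ ideal_generated (fun i : 'I_m => mvar i ^+ d) q ->
  exists2 a, mcoeff a q != 0 & forall i, (a i < d)%N.
Proof.
apply: contra_notP => H.
have big a : a \in msupp q -> exists i : 'I_m, (d <= a i)%N.
  rewrite mcoeff_msupp => qa; apply: contrapT => Na; apply: H; exists a => // i.
  by rewrite ltnNge; apply/negP => ai; apply: Na; exists i.
have [f fP] : exists f : multinom m -> option 'I_m, forall a, a \in msupp q ->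
    exists2 i, f a = Some i & (d <= a i)%N.
  exists (fun a => [pick i | (d <= a i)%N]) => a /big[i ai].
  by case: pickP => [j aj|/(_ i)]; [exists j|rewrite ai].
exists (fun i => \sum_(a <- msupp q | f a == Some i)
  mcoeff a q *: mpolyX 'F_2 (mnm_sub a (mnm_muln (mnm1 i) d))).
under eq_bigr do rewrite mulr_suml.
rewrite (exchange_big_dep xpredT) //= {1}[q]mpolyE !big_seq.
apply: eq_bigr => a /fP[i fa ai]; rewrite fa (big_pred1 i) => [|j]; last first.
  by rewrite eq_sym.
rewrite -scalerAl mpolyXn -mpolyXD submK//.
apply/mnm_lepP => j; rewrite mulmnE mnm1E.
by have [<-|] := eqVneq i j; rewrite ?mul1n// mul0n.
Qed.

(** Homogeneity; it matches the number of functions with the dimension of the product of spheres. *)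
Lemma mdeg_prod_linear_form (ls : seq ('I_m -> 'F_2)) a :
  mcoeff a (\prod_(l <- ls) linear_form l) != 0 -> mdeg a = size ls.
Proof.
elim: ls a => [|l ls IH] a.
  rewrite big_nil mcoeff1 -mdeg_eq0 /=.
  by case: (mdeg a =P 0%N) => // _; rewrite eqxx.
rewrite big_cons mcoeff_linear_form => a0.
have [i] : exists i, (if (0 < a i)%N then l i * mcoeff (mnm_sub a (mnm1 i))
    (\prod_(l <- ls) linear_form l) else 0) != 0.
  apply: contrapT => H; move/negP: a0; apply; apply/eqP.
  by apply: big1 => i _; apply/eqP/negPn/negP => Hi; apply: H; exists i.
case: ifP => [ai|]; last by rewrite eqxx.
rewrite mulf_eq0 => /norP[_ /IH sz] /=; rewrite -sz.
have : mdeg a = mdeg (mnm_add (mnm_sub a (mnm1 i)) (mnm1 i)).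
  by rewrite submK// lep1mP -lt0n.
by rewrite mdegD mdeg1 addn1.
Qed.

End DicksonProduct.

(** * A Borsuk-Ulam theorem for products of spheres *)

Section BorsukUlam.
Variables (R : realType) (m d : nat).
Notation coord := ('I_m * 'I_d)%type.
Implicit Types (t : coord -> R) (Y : 'M[R]_(m, d)).

(** Spherical coordinates; when the last angle is 0, the last entry of a row is the product of the
    sines of the other angles. *)
Definition sphere_point t : 'M[R]_(m, d) :=
  \matrix_(i, r) ((\prod_(q < d | (q < r)%N) sin (t (i, q))) * cos (t (i, r))).

Definition flip_row (i : 'I_m) Y : 'M[R]_(m, d) :=
  \matrix_(j, r) (if j == i then - Y j r else Y j r).

Definition nonzero_rows Y := forall i, row i Y != 0.

(** At the first angle with zero sine, the cosine and all earlier sines are nonzero. Such an angle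
    exists, since the last one is 0. *)
Lemma sphere_point_rows t : (0 < d)%N ->
  (forall p : coord, p.2.+1 = d -> t p = 0) -> nonzero_rows (sphere_point t).
Proof.
move=> d0 tlast i.
have [|r /andP[rd /forallP]] := @ex_minnP (fun r =>
  (r < d)%N && [forall q : 'I_d, (q == r :> nat) ==> (sin (t (i, q)) == 0)]).
  exists d.-1; rewrite prednK// leqnn /=; apply/forallP => q;
    apply/implyP => /eqP qd.
  by rewrite tlast ?sin0//= qd prednK.
move=> /(_ (Ordinal rd)); rewrite /= eqxx /= => /eqP sr rmin.
apply/eqP => /rowP /(_ (Ordinal rd)) /eqP;
  rewrite !mxE mulf_eq0 prodf_seq_eq0 /=.
move=> /orP[/hasP[q _ /andP[qr /eqP sq]]|/eqP cr]; last first.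
  by have := cos2Dsin2 (t (i, Ordinal rd)); rewrite cr sr expr0n addr0 => /eqP;
    rewrite eq_sym oner_eq0.
have := rmin q; rewrite (leqNgt r) [(q < r)%N]qr ltn_ord /= => H; apply: notF;
  apply: H.
by apply/forallP => q'; apply/implyP => /eqP/val_inj ->; rewrite sq.
Qed.

(** An odd function of each nonzero row: the picked entry depends only on the support of the row,
    which [flip_row] preserves. *)
Definition row_sign Y (i : 'I_m) : 'F_2 :=
  if [pick r | Y i r != 0] is Some r then (Y i r < 0)%R%:R else 0.

Lemma row_sign_flip Y i j : nonzero_rows Y ->
  row_sign (flip_row i Y) j = row_sign Y j + (j == i)%:R.
Proof.
move=> Y0; rewrite /row_sign.
have -> : [pick r | flip_row i Y j r != 0] = [pick r | Y j r != 0].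
  by apply: eq_pick => r; rewrite /= mxE; case: (j == i); rewrite ?oppr_eq0.
case: pickP => [r Yr|Yj]; last first.
  by case/eqP: (Y0 j); apply/rowP => r; rewrite !mxE; apply/eqP/negPn;
    rewrite Yj.
rewrite mxE; case: eqP => [_|]; last by rewrite addr0.
rewrite oppr_lt0; case: ltgtP Yr => // _ _; exact/val_inj.
Qed.

Variables (J : finType) (c : J -> {ffun 'I_m -> bool}).
Variable f : J -> 'M[R]_(m, d) -> R.
Hypothesis f_flip : forall j i Y, nonzero_rows Y ->
  f j (flip_row i Y) = (-1) ^+ c j i * f j Y.

(* At the zeros of [f j] the sign is chosen so as to stay equivariant. *)
Definition fsign j Y : 'F_2 :=
  if f j Y == 0 then \sum_i boolform (c j) i * row_sign Y i
  else (f j Y < 0)%R%:R.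

Lemma fsign_flip j i Y : nonzero_rows Y ->
  fsign j (flip_row i Y) = fsign j Y + boolform (c j) i.
Proof.
move=> Y0; rewrite /fsign f_flip// mulf_eq0 signr_eq0 /=.
case: eqP => [fY0|/eqP fY0].
  under eq_bigr => k _ do rewrite row_sign_flip// mulrDr.
  rewrite big_split /= [X in _ + X](bigD1 i)//= eqxx mulr1.
  by rewrite [X in _ + (_ + X)]big1 ?addr0// => k ki; rewrite (negbTE ki) mulr0.
rewrite /boolform; case: (c j i); last by rewrite expr0 mul1r addr0.
rewrite expr1 mulN1r oppr_lt0; case: ltgtP fY0 => // _ _; exact/val_inj.
Qed.

Lemma fsign_neq j Y Z : fsign j Y != fsign j Z -> f j Y * f j Z <= 0.
Proof.
rewrite /fsign; have [->|Y0] := eqVneq (f j Y) 0; first by rewrite mul0r.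
have [->|Z0] := eqVneq (f j Z) 0; first by rewrite mulr0.
case: ltgtP Y0 => // Y0 _; case: ltgtP Z0 => // Z0 _; rewrite ?eqxx// => _.
  by rewrite mulr_le0_ge0 ?ltW.
by rewrite mulr_ge0_le0 ?ltW.
Qed.

Section grid.
Variable n : nat.
Hypothesis n0 : (0 < n)%N.

Definition angle (u : coord -> int) : coord -> R :=
  fun p => pi * (u p)%:~R / n.*2%:R.

Lemma angle0 u p : u p = 0 -> angle u p = 0.
Proof. by rewrite /angle => ->; rewrite mulr0 mul0r. Qed.

Let n2 : n.*2%:R != 0 :> R.
Proof. by rewrite pnatr_eq0 double_eq0 -lt0n. Qed.

Lemma angle_pi u p : u p = n.*2%:Z -> angle u p = pi.
Proof. by rewrite /angle => ->; rewrite -pmulrn mulfK. Qed.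

Lemma angle_sub u p v q : u p = n.*2%:Z - v q -> angle u p = pi - angle v q.
Proof.
by rewrite /angle => ->; rewrite intrB -pmulrn mulrBr mulrBl mulfK.
Qed.

(** A zero sine annihilates all later entries of the row, and the other entries do not involve the
    modified angle. *)
Lemma spherical_sphere_point (s : 'M[R]_(m, d) -> 'F_2) :
  spherical n (fun u => s (sphere_point (angle u))).
Proof.
move=> u i r q x rq u02; congr s; apply/matrixP => j p; rewrite !mxE.
have s0 v : v (i, r) = u (i, r) -> (r < p)%N ->
    \prod_(k < d | (k < p)%N) sin (angle v (i, k)) = 0.
  move=> vu rp; rewrite (bigD1 r)//=; case: u02 => u0.
    by rewrite angle0 ?sin0 ?mul0r// vu.
  by rewrite angle_pi ?sinpi ?mul0r// vu.
have [->|ji] := eqVneq j i; last first.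
  have E k : angle (upd u (i, q) x) (j, k) = angle u (j, k).
    by rewrite /angle updN// xpair_eqE negb_and ji.
  by rewrite E; congr (_ * _); apply: eq_bigr => k _; rewrite E.
have [rp|pr] := ltnP r p.
  rewrite !s0 ?mul0r// updN// xpair_eqE eqxx -[r == q]val_eqE /=.
  by rewrite neq_ltn rq.
have E (k : 'I_d) : (k <= p)%N -> angle (upd u (i, q) x) (i, k) =
    angle u (i, k).
  move=> kp; rewrite /angle updN// xpair_eqE eqxx -[k == q]val_eqE /=.
  by rewrite neq_ltn (leq_ltn_trans kp)// (leq_ltn_trans pr).
by rewrite E//; congr (_ * _); apply: eq_bigr => k /ltnW kp; rewrite E.
Qed.

(** Taking the supplement of an angle preserves the sine and negates the cosine. So the entries
    before [r] change sign, the entry [r] does because cos pi = - cos 0, and the later ones vanish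
    on this face. *)
Lemma sphere_point_reflect u i r : u (i, r) = 0 ->
  sphere_point (angle (reflect n i r u)) = flip_row i (sphere_point (angle u)).
Proof.
move=> u0; apply/matrixP => j p; rewrite !mxE.
have [->|ji] := eqVneq j i; last first.
  have E k : angle (reflect n i r u) (j, k) = angle u (j, k).
    by rewrite /angle /reflect /= (negbTE ji).
  by rewrite E; congr (_ * _); apply: eq_bigr => k _; rewrite E.
have below (k : 'I_d) : (k < r)%N ->
    angle (reflect n i r u) (i, k) = pi - angle u (i, k).
  by move=> kr; apply: angle_sub; rewrite /reflect /= eqxx kr.
have at_r : angle (reflect n i r u) (i, r) = pi.
  by apply: angle_pi; rewrite /reflect /= !eqxx ltnn.
have sinpiB x : sin (pi - x) = sin x :> R.
  by rewrite sinB sinpi cospi mul0r sub0r mulN1r opprK.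
have cospiB x : cos (pi - x) = - cos x :> R.
  by rewrite cosB sinpi cospi mul0r addr0 mulN1r.
have [rp|pr] := ltnP r p.
  have s0 v : sin (v (i, r)) = 0 ->
      \prod_(k < d | (k < p)%N) sin (v (i, k)) = 0 :> R.
    by move=> v0; rewrite (bigD1 r)//= v0 mul0r.
  by rewrite !s0 ?mul0r ?oppr0// ?at_r ?sinpi// angle0 ?sin0.
rewrite -mulrN; congr (_ * _).
  by apply: eq_bigr => k kp; rewrite below ?(leq_trans kp).
move: pr; rewrite leq_eqVlt => /predU1P[/val_inj ->|pr].
  by rewrite at_r cospi angle0// cos0.
by rewrite below.
Qed.

Hypothesis d0 : (0 < d)%N.

Lemma equivariant_fsign j :
  equivariant n (fun u => fsign j (sphere_point (angle u))) (boolform (c j)).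
Proof.
move=> u i r rd u0 ulast; rewrite sphere_point_reflect// fsign_flip//.
by apply: sphere_point_rows => // p /ulast; exact: angle0.
Qed.

Variable a : multinom m.
Hypothesis ad : forall i, (a i < d)%N.
Hypothesis a_prod : mcoeff a (\prod_j linear_form (boolform (c j))) != 0.

(** The cup product of the signs is a nonzero coefficient, so it is nonzero on some cell, whose
    centre serves as [t]: every sign changes between two points of that cell. *)
Lemma approx_zero : exists t, [/\ forall p, 0 <= t p <= pi,
  forall p : coord, p.2.+1 = d -> t p = 0 &
  forall j, exists t1 t2, [/\ f j (sphere_point t1) * f j (sphere_point t2)
    <= 0,
    forall p : coord, p.2.+1 = d -> t1 p = 0 /\ t2 p = 0 &
    forall p, `|t1 p - t p| <= pi / n.*2%:R /\ `|t2 p - t p| <= pi / n.*2%:R]].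
Proof.
pose ls := [seq ((fun u => fsign j (sphere_point (angle u))),
  boolform (c j)) | j <- index_enum J].
have a_ls : \prod_(l <- ls) linear_form l.2 = \prod_j
    linear_form (boolform (c j)).
  by rewrite big_map.
have adeg : mdeg a = size ls.
  rewrite -(size_map snd); apply: mdeg_prod_linear_form.
  by rewrite big_map a_ls.
have eqls l : List.In l ls -> spherical n l.1 /\ equivariant n l.1 l.2.
  rewrite /ls; elim: (index_enum J) => //= j js IH [<-|//].
  by split; [exact: spherical_sphere_point|exact: equivariant_fsign].
have := cup_product_coeff (enum_uniq (expset d a)) (fun p =>
  esym (mem_enum _ p)) ad adeg eqls.
rewrite a_ls => cupE.
have /cellsum_neq0[u [uflag uN uL]] : cellsum n (enum (expset d a))
    (fun v => flagsum v (expset d a) (map fst ls)) (fun=> 0) <> 0.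
  by rewrite cupE; apply/eqP.
have last_notin (p : coord) : p.2.+1 = d -> p \notin expset d a.
  by move=> pd; rewrite inE -leqNgt -ltnS pd.
have u_last (p : coord) : p.2.+1 = d -> u p = 0.
  by move=> /last_notin pa; apply: uN; rewrite mem_enum.
exists (angle u); split.
- move=> p; have : 0 <= u p <= n.*2%:Z.
    have [pa|pa] := boolP (p \in expset d a); first by apply: uL;
      rewrite mem_enum.
    by rewrite uN ?mem_enum.
  move=> /andP[up0 upn]; have n20 : 0 < n.*2%:R :> R
    by rewrite ltr0n double_gt0.
  rewrite /angle -mulrA; apply/andP; split.
    by rewrite mulr_ge0 ?pi_ge0// divr_ge0 ?ler0z// ltW.
  rewrite ger_pMr ?pi_gt0// ler_pdivrMr// mul1r pmulrn.
  by rewrite ler_int.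
- by move=> p /u_last; exact: angle0.
move=> j; have sj : List.In (fun u => fsign j (sphere_point (angle u))) (map fst
  ls).
  rewrite /ls -map_comp; have := mem_index_enum j.
  elim: (index_enum J) => //= j' js IH; rewrite inE => /predU1P[->|/IH];
    first by left.
  by right.
have [v [w [vw vwu dvw]]] := flagsum_nonconst uflag sj.
have ang_dist x p : `|x p - u p| <= 1 ->
  `|angle x p - angle u p| <= pi / n.*2%:R.
  move=> xu; rewrite /angle -mulrBl -mulrBr -intrB normrM normrM.
  rewrite [`|pi|]ger0_norm ?pi_ge0// [`|_^-1|]ger0_norm ?invr_ge0//.
  rewrite ler_wpM2r ?invr_ge0// ger_pMr ?pi_gt0//.
  by rewrite -intr_norm lerz1.
exists (angle v), (angle w); split.
- exact: fsign_neq.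
- move=> p pd; have [vp wp] := vwu p (last_notin p pd).
  by rewrite !angle0 ?vp ?wp ?u_last.
- by move=> p; have [? ?] := dvw p; split; exact: ang_dist.
Qed.

End grid.

Lemma sphere_point_continuous (v : 'rV[R]_(m * d)) :
  {for v, continuous (fun v : 'rV[R]_(m * d) =>
    sphere_point (fun p => v ord0 (mxvec_index p.1 p.2)))}.
Proof.
pose t (v : 'rV[R]_(m * d)) (p : coord) := v ord0 (mxvec_index p.1 p.2).
have tc w p : {for w, continuous (t ^~ p)} by exact: coord_continuous.
move=> A [P vP PA].
have : \forall w \near v, forall i r, P i r (sphere_point (t w) i r).
  apply: (@filter_forall _ _
    (fun i w => forall r, P i r (sphere_point (t w) i r)) (nbhs v)) => i.
  apply: (@filter_forall _ _
    (fun r w => P i r (sphere_point (t w) i r)) (nbhs v)) => r.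
  have : (fun w => sphere_point (t w) i r) @ v --> sphere_point (t v) i r.
    under eq_fun do rewrite mxE.
    rewrite mxE; apply: (@cvgM _ _ (nbhs v) _
      (fun w => \prod_(q < d | (q < r)%N) sin (t w (i, q)))
      (fun w => cos (t w (i, r)))).
      apply: (@continuous_big R _ (fun x y => x * y) 1 (fun q : 'I_d =>
        (q < r)%N)
        (@mul_continuous R) _ _ (fun q w => sin (t w (i, q)))) => q _ w.
      by apply: continuous_comp (tc w _) _; exact: continuous_sin.
    by apply: continuous_comp (tc v _) _; exact: continuous_cos.
  by apply; exact: vP.
by apply: filterS => w wP; exact: PA.
Qed.

(** Approximate zeros on finer and finer grids accumulate in a compact box. If some [f j] were
    nonzero at a cluster point, it would keep its sign nearby, against the sign changes on small
    cells. *)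
Theorem borsuk_ulam_product (a : multinom m) : (0 < d)%N ->
  (forall j Y, nonzero_rows Y -> {for Y, continuous (f j)}) ->
  (forall i, (a i < d)%N) ->
  mcoeff a (\prod_j linear_form (boolform (c j))) != 0 ->
  exists2 Y, nonzero_rows Y & forall j, f j Y = 0.
Proof.
move=> d0 fc ad a_prod; apply: contrapT => noz.
pose t (v : 'rV[R]_(m * d)) (p : coord) := v ord0 (mxvec_index p.1 p.2).
have tK (g : coord -> R) : t (mxvec (\matrix_(i, r) g (i, r))) = g.
  by apply/funext => -[i r]; rewrite /t mxvecE mxE.
(* The dummy last angles are frozen at 0, the others range over [0, pi]. *)
pose B (k : 'I_(m * d)) : set R := if [exists p : coord,
  (p.2.+1 == d) && (k == mxvec_index p.1 p.2)]
  then [set 0] else `[0, pi]%classic.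
pose K : set 'rV[R]_(m * d) := [set v | forall k, B k (v ord0 k)].
have Kc : compact K.
  apply: rV_compact => k; rewrite /B; case: ifP => _; first exact: compact_set1.
  exact: segment_compact.
have /choice[x xP] : forall n, exists x, K x /\
  forall j, exists t1 t2, [/\ f j (sphere_point t1) * f j (sphere_point t2)
    <= 0,
    forall p : coord, p.2.+1 = d -> t1 p = 0 /\ t2 p = 0 &
    forall p, `|t1 p - t x p| <= pi / n.+1.*2%:R /\
              `|t2 p - t x p| <= pi / n.+1.*2%:R].
  move=> n; have [g [g0 glast gj]] := approx_zero (ltn0Sn n) d0 ad a_prod.
  exists (mxvec (\matrix_(i, r) g (i, r))); split; last by rewrite tK.
  move=> k; case/mxvec_indexP: k => i r; rewrite mxvecE mxE /B.
  case: ifPn => [/existsP[[i' r'] /andP[/eqP r'd /eqP]]|_] /=.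
    move=> e; rewrite -(glast (i', r') r'd).
    by have := mxvecE (\matrix_(i, r) g (i, r)) i' r'; rewrite -e mxvecE !mxE.
  by rewrite in_itv /=.
have [p [Kp clp]] : K `&` cluster (x @ \oo) !=set0.
  by apply: Kc; exists 0%N => // n _ /=; exact: (xP n).1.
have plast (q : coord) : q.2.+1 = d -> t p q = 0.
  move=> qd; have := Kp (mxvec_index q.1 q.2); rewrite /B ifT//.
  by apply/existsP; exists q; rewrite qd !eqxx.
have pY := sphere_point_rows d0 plast.
have [j fj] : exists j, f j (sphere_point (t p)) != 0.
  apply: contrapT => H; apply: noz; exists (sphere_point (t p));
    first exact: pY.
  move=> j.
  by apply/eqP/negPn/negP => Hj; apply: H; exists j.
pose h (v : 'rV[R]_(m * d)) := f j (sphere_point (t v)) *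
  f j (sphere_point (t p)).
have hp : 0 < h p by rewrite /h -expr2 exprn_even_gt0.
have hc : h @ p --> h p.
  apply: (@cvgM _ _ (nbhs p) _ (fun v => f j (sphere_point (t v)))
    (fun=> f j (sphere_point (t p)))); last exact: cvg_cst.
  apply: (@continuous_comp _ _ _ (fun v => sphere_point (t v)) (f j)).
    exact: sphere_point_continuous.
  exact: fc.
have : \forall v \near p, 0 < h v by exact: (cvgr_gt _ hc).
move=> /nbhs_ballP[e /= e0 eh].
(* Half of the radius bounds the grid size, the other half the distance from [x n] to the cluster
   point. *)
have [N NN] : exists N, forall n, (N <= n)%N -> pi / n.+1.*2%:R < e / 2.
  have epi : 0 < e / pi by rewrite divr_gt0 ?pi_gt0.
  have [N _ NP] := near_infty_natSinv_lt (PosNum epi); exists N => n /NP /= n1.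
  rewrite -muln2 natrM invfM mulrA ltr_pM2r ?invr_gt0//.
  by rewrite mulrC -ltr_pdivlMr ?pi_gt0.
have [||y []] := clp (x @` [set n | (N <= n)%N]) (ball p (e / 2)).
- by exists N => // n Nn /=; exists n.
- by apply/nbhs_ballP; exists (e / 2); rewrite //= divr_gt0.
move=> [n Nn <-] xnp; have [_ /(_ j) [t1 [t2 [t12 _ tx]]]] := xP n.
have inball g : (forall q, `|g q - t (x n) q| <= pi / n.+1.*2%:R) ->
    0 < f j (sphere_point g) * f j (sphere_point (t p)).
  move=> gx; pose v : 'rV[R]_(m * d) := mxvec (\matrix_(i, r) g (i, r)).
  rewrite -[g]tK -/v; apply: eh.
  rewrite [e]splitr; apply: (ball_triangle xnp); split;
    first by rewrite divr_gt0.
  move=> i k; rewrite (ord1 i); case/mxvec_indexP: k => i' r'.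
  rewrite /ball /= distrC (le_lt_trans _ (NN n Nn))//.
  by have := gx (i', r'); rewrite /v mxvecE mxE.
have h1 := inball t1 (fun q => (tx q).1).
have h2 := inball t2 (fun q => (tx q).2).
have : 0 < (f j (sphere_point t1) * f j (sphere_point t2)) *
   (f j (sphere_point (t p))) ^+ 2.
  by rewrite expr2 mulrACA mulr_gt0.
by rewrite pmulr_lgt0 ?exprn_even_gt0// ltNge t12.
Qed.

End BorsukUlam.

(** * Hyperplanes, half-spaces and quantiles *)

Section NullHyperplane.
Variable R : realType.

(** If a later coefficient is nonzero, each slice at a fixed first coordinate is a hyperplane in
    lower dimension, null by induction. Otherwise the set is a point times the whole space. *)
Lemma lebesgue_tuple_hyperplane n (u : 'I_n -> R) (b : R) :
  (exists i, u i != 0) ->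
  lebesgue_tuple R n [set t | \sum_i u i * tnth t i = b] = 0%E.
Proof.
elim: n u b => [|n IH] u b; first by case=> -[].
move=> [i ui]; rewrite /= /lebesgue_tuple_step /pushforward.
set E := (X in (_ \x _)%E X).
have EE : E = [set p | u ord0 * p.1 + \sum_(j < n) u (lift ord0 j) * tnth p.2 j
  = b].
  have consE p : \sum_i u i * tnth (tuple_cons p) i =
      u ord0 * p.1 + \sum_(j < n) u (lift ord0 j) * tnth p.2 j.
    rewrite big_ord_recl; congr (_ + _); apply: eq_bigr => j _; congr (_ * _).
    by rewrite !(tnth_nth p.1).
  by apply/seteqP; split => p; rewrite /E /= consE.
have [tail0|] := pselect (forall j, u (lift ord0 j) = 0); last first.
  move=> /existsNP[j /eqP uj].
  rewrite /product_measure1 integral0_eq// => x _ /=.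
  rewrite -(IH (fun j => u (lift ord0 j)) (b - u ord0 * x)); last by exists j.
  congr (lebesgue_tuple R n _); apply/seteqP; split => t /=.
    by rewrite /xsection /= inE EE /= => <-; rewrite addrC addKr.
  by rewrite /xsection /= inE EE /= => ->; rewrite addrC subrK.
have u0 : u ord0 != 0.
  by move: ui; case: (unliftP ord0 i) => [j|] -> //; rewrite tail0 eqxx.
have -> : E = [set b / u ord0] `*` setT.
  rewrite EE; apply/seteqP; split => -[x t] /=;
    rewrite big1 ?addr0 => [|j _]; rewrite ?tail0 ?mul0r//.
    by move=> <-; split => //; rewrite mulrC mulKf.
  by move=> [-> _]; rewrite mulrC divfK.
have l0 : @lebesgue_measure R [set b / u ord0] = 0%E
  by exact: lebesgue_measure_set1.
(* The other factor may be infinite; its product with 0 is 0 by convention. *)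
by rewrite product_measure1E// [X in (X * _)%E]l0 mul0e.
Qed.

Lemma lebesgue_hyperplane d (u : 'rV[R]_d) (b : R) : u != 0 ->
  lebesgue R d [set x | dot u x = b] = 0%E.
Proof.
move=> u0; rewrite /lebesgue /pushforward /=.
rewrite -(@lebesgue_tuple_hyperplane d (u ord0) b).
  congr (lebesgue_tuple R d _); apply/seteqP; split => t /= <-;
  by apply: eq_bigr => i _; rewrite mxE.
apply: contrapT => H; move/eqP: u0; apply; apply/rowP => i; rewrite mxE.
by apply/eqP/negPn/negP => ui; apply: H; exists i.
Qed.

End NullHyperplane.

Lemma sum_continuous_at (R : realType) (T : topologicalType) (I : finType)
    (F : I -> T -> R) (t : T) : (forall i, {for t, continuous (F i)}) ->
  {for t, continuous (fun x => \sum_i F i x)}.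
Proof.
move=> Fc; apply: (@cvg_big R _ (fun x y => x + y) 0 xpredT).
  by move=> z; apply: cvgD; [exact: cvg_fst|exact: cvg_snd].
by move=> i _; exact: Fc.
Qed.

Lemma sum_continuous (R : realType) (T : topologicalType) (I : finType)
    (F : I -> T -> R) :
  (forall i, continuous (F i)) -> continuous (fun x => \sum_i F i x).
Proof. by move=> Fc t; apply: sum_continuous_at => i; exact: Fc. Qed.

Section Dot.
Variables (R : realType) (d : nat).
Implicit Types (u x y : 'rV[R]_d) (b : R).

Lemma dotZr u a x : dot u (a *: x) = a * dot u x.
Proof. by rewrite /dot mulr_sumr; apply: eq_bigr => i _;
  rewrite mxE mulrCA. Qed.

Lemma dotZl u a x : dot (a *: u) x = a * dot u x.
Proof. by rewrite /dot mulr_sumr; apply: eq_bigr => i _; rewrite mxE mulrA. Qed.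

Lemma dotNl u x : dot (- u) x = - dot u x.
Proof. by rewrite -scaleN1r dotZl mulN1r. Qed.

Lemma dot_gt0 u : u != 0 -> 0 < dot u u.
Proof.
move=> u0; rewrite lt_neqAle eq_sym; apply/andP; split; last first.
  by apply: sumr_ge0 => i _; rewrite -expr2 sqr_ge0.
apply: contra u0; rewrite psumr_eq0; last by move=> i _; rewrite -expr2 sqr_ge0.
move=> /allP u0; apply/eqP/rowP => i; rewrite mxE.
by have := u0 i (mem_index_enum i); rewrite /= -expr2 sqrf_eq0 => /eqP.
Qed.

Lemma dot_continuous u : continuous (dot u : 'rV[R]_d -> R).
Proof.
apply: sum_continuous => i x.
by apply: continuousM; [exact: cst_continuous|exact: coord_continuous].
Qed.

Definition norm1 x : R := \sum_i `|x ord0 i|.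

Lemma norm1_continuous : continuous norm1.
Proof.
apply: sum_continuous => i x.
by apply: continuous_comp; [exact: coord_continuous|exact: norm_continuous].
Qed.

Lemma dot_bound u (v x : 'rV[R]_d) e :
  (forall i, `|u ord0 i - v ord0 i| <= e) ->
  `|dot u x - dot v x| <= e * norm1 x.
Proof.
move=> uv; rewrite /dot -sumrB mulr_sumr (le_trans (ler_norm_sum _ _ _))//.
by apply: ler_sum => i _; rewrite -mulrBl normrM ler_wpM2r.
Qed.

End Dot.

(** * Masses of cells and their continuity *)

Section Mass.
Variables (R : realType) (d : nat).
Variable mu : {finite_measure set (euclidean R d) -> \bar R}.
Implicit Types (A B E : set (euclidean R d)) (u : 'rV[R]_d) (b e p : R).

Lemma closed_measurable_euclidean A : closed (A : set 'rV[R]_d) -> measurable A.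
Proof.
move=> cA; rewrite -[A]setCK; apply: measurableC.
by apply: sub_sigma_algebra; exact: closed_openC.
Qed.

Lemma measurable_forall (I : finType) (E : I -> set (euclidean R d)) :
  (forall i, measurable (E i)) -> measurable [set x | forall i, E i x].
Proof.
move=> mE; have -> : [set x | forall i, E i x] = \bigcap_(i in [set: I]) E i.
  by apply/seteqP; split => x /= Ex i //; exact: Ex.
by apply: fin_bigcap_measurable.
Qed.

Definition mass A : R := fine (mu A).

Lemma massE A : measurable A -> mu A = (mass A)%:E.
Proof. by move=> mA; rewrite /mass fineK// fin_num_measure. Qed.

Lemma mass0 : mass set0 = 0.
Proof. by rewrite /mass measure0. Qed.

Lemma mass_ge0 A : 0 <= mass A.
Proof. exact/fine_ge0/measure_ge0. Qed.

Lemma massU A B : measurable A -> measurable B -> A `&` B = set0 ->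
  mass (A `|` B) = mass A + mass B.
Proof.
move=> mA mB AB; apply: EFin_inj; rewrite EFinD -!massE//;
  last exact: measurableU.
exact: measureU.
Qed.

Lemma mass_setID A B : measurable A -> measurable B ->
  mass A = mass (A `&` B) + mass (A `\` B).
Proof.
move=> mA mB; rewrite -massU ?setUIDK//; first exact: measurableI.
  exact: measurableD.
by rewrite -subset0 => x [[_ ?] []].
Qed.

Lemma le_mass A B : measurable A -> measurable B -> A `<=` B ->
  mass A <= mass B.
Proof.
move=> mA mB AB; rewrite (mass_setID mB mA) (_ : B `&` A = A) ?lerDl
  ?mass_ge0//.
exact/setIidPr.
Qed.

Lemma mass_exists_le (I : finType) (E : I -> set (euclidean R d)) :
  (forall i, measurable (E i)) ->
  measurable [set x | exists i, E i x] /\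
  mass [set x | exists i, E i x] <= \sum_i mass (E i).
Proof.
move=> mE; pose U (s : seq I) := [set x | exists2 i, i \in s & E i x].
have H s : measurable (U s) /\ mass (U s) <= \sum_(i <- s) mass (E i).
  elim: s => [|i s [mU leU]].
    rewrite (_ : U [::] = set0); last by rewrite -subset0 => x [].
    by rewrite big_nil mass0; split => //; exact: measurable0.
  have -> : U (i :: s) = E i `|` U s.
    apply/seteqP; split => x /=.
      by move=> [j]; rewrite inE => /predU1P[->|js Ej]; [left|right; exists j].
    move=> [Ei|[j js Ej]]; first by exists i => //; rewrite inE eqxx.
    by exists j => //; rewrite inE js orbT.
  split; first exact: measurableU.
  rewrite big_cons (le_trans _ (lerD (lexx _) leU))//.
  rewrite -lee_fin EFinD -!massE//; last exact: measurableU.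
  exact: measureU2.
have [] := H (index_enum I).
have -> : U (index_enum I) = [set x | exists i, E i x].
  apply/seteqP; split => x; first by move=> [i _ Ei]; exists i.
  by move=> [i Ei]; exists i => //; rewrite mem_index_enum.
by [].
Qed.

Lemma mass_diff_le A B E : measurable A -> measurable B -> measurable E ->
  A `\` B `<=` E -> B `\` A `<=` E -> `|mass A - mass B| <= mass E.
Proof.
move=> mA mB mE AB BA.
suff H A' B' : measurable A' -> measurable B' -> A' `\` B' `<=` E ->
    mass A' - mass B' <= mass E by rewrite ler_norml lerNl opprB !H.
move=> mA' mB' A'B'; rewrite lerBlDl (mass_setID mA' mB') lerD// le_mass//.
- exact: measurableI.
- exact: measurableD.
Qed.

Lemma sum_mass_fibers (W : finType) (h : euclidean R d -> W) (Q : pred W) :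
  (forall w, measurable (h @^-1` [set w])) ->
  \sum_(w | Q w) mass (h @^-1` [set w]) = mass [set x | Q (h x)].
Proof.
move=> mh; pose U (s : seq W) := [set x | (h x \in s) && Q (h x)].
have H s : uniq s -> measurable (U s) /\
    \sum_(w <- s | Q w) mass (h @^-1` [set w]) = mass (U s).
  elim: s => [_|w s IH /= /andP[ws /IH[mU sumU]]].
    rewrite big_nil (_ : U [::] = set0) ?mass0//.
    by rewrite -subset0.
  rewrite big_cons; case: ifPn => [Qw|NQw].
    have -> : U (w :: s) = h @^-1` [set w] `|` U s.
      apply/seteqP; split => x /=; rewrite /U /= inE.
        by move=> /andP[/predU1P[->|hs] Qx]; [left|right; rewrite hs].
      by move=> [->|/andP[-> ->]]; rewrite ?eqxx ?orbT.
    split; first exact: measurableU.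
    rewrite massU ?sumU//.
    by rewrite -subset0 => x [/= hw]; rewrite /U /= hw (negbTE ws).
  have -> // : U (w :: s) = U s.
  apply/seteqP; split => x /=; rewrite /U /= inE.
    by move=> /andP[/predU1P[->|-> ->//]]; rewrite (negbTE NQw).
  by move=> /andP[-> ->]; rewrite orbT.
have [_ ->] := H _ (index_enum_uniq W).
by congr mass; apply/seteqP; split => x; rewrite /U /= mem_index_enum.
Qed.

(** A variant of [half_space] with free normal vector and offset, so that these can vary
    continuously. *)
Definition halfspace u b (s : bool) : set (euclidean R d) :=
  [set x | if s then b <= dot u x else dot u x <= b].

Lemma measurable_halfspace u b s : measurable (halfspace u b s).
Proof.
apply: closed_measurable_euclidean; rewrite /halfspace; case: s.
  apply: (@closed_comp _ _ (dot u) [set y | b <= y]); last exact: closed_ge.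
  by move=> x _; exact: dot_continuous.
apply: (@closed_comp _ _ (dot u) [set y | y <= b]); last exact: closed_le.
by move=> x _; exact: dot_continuous.
Qed.

Lemma measurable_hyperplane u b :
  measurable [set x : euclidean R d | dot u x = b].
Proof.
rewrite (_ : [set _ | _] = halfspace u b true `&` halfspace u b false).
  by apply: measurableI; exact: measurable_halfspace.
apply/seteqP; split => x /=; rewrite /halfspace /=; first by move=> ->.
by move=> [bx xb]; apply/eqP; rewrite eq_le xb bx.
Qed.

Hypothesis mu_hyperplane : forall u b, u != 0 -> mu [set x | dot u x = b] = 0%E.

(** Contains the points that change side when [u] and [b] move by at most [e]; the width grows with
    the norm, since a rotation moves far points more. *)
Definition strip u b e : set (euclidean R d) :=
  [set x | `|dot u x - b| <= e * (1 + norm1 x)].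

Lemma measurable_strip u b e : measurable (strip u b e).
Proof.
apply: closed_measurable_euclidean.
rewrite (_ : strip u b e =
    [set x | 0 <= e * (1 + norm1 x) - `|dot u x - b|]); last first.
  by apply/seteqP; split => x; rewrite /strip /= subr_ge0.
apply: (@closed_comp _ _ (fun x => e * (1 + norm1 x) - `|dot u x - b|)
  [set y | 0 <= y]); last exact: closed_ge.
move=> x _; apply: (@cvgB _ _ _ (nbhs x) _ (fun x => e * (1 + norm1 x))
  (fun x => `|dot u x - b|)).
  apply: (@cvgM _ _ (nbhs x) _ (fun=> e) (fun x => 1 + norm1 x));
    first exact: cvg_cst.
  by apply: (@cvgD _ _ _ (nbhs x) _ (fun=> 1 : R) (@norm1 R d));
    [exact: cvg_cst|exact: norm1_continuous].
apply: (@cvg_norm _ _ _ (nbhs x) _ (fun x => dot u x - b)).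
apply: (@cvgB _ _ _ (nbhs x) _ (dot u) (fun=> b));
  [exact: dot_continuous|exact: cvg_cst].
Qed.

Lemma norm1_ge0 (x : 'rV[R]_d) : 0 <= norm1 x.
Proof. by apply: sumr_ge0. Qed.

(** The strips decrease to a null hyperplane and [mu] is finite, so their masses tend to 0. *)
Lemma strip_small u b e : u != 0 -> 0 < e ->
  exists2 r, 0 < r & mass (strip u b r) < e.
Proof.
move=> u0 e0; pose F n := strip u b n.+1%:R^-1.
have FI : \bigcap_n F n = [set x | dot u x = b].
  apply/seteqP; split => x /=; last first.
    by move=> ub n _; rewrite /F /strip /= ub subrr normr0 mulr_ge0// addr_ge0//
      norm1_ge0.
  move=> Fx; apply/eqP; rewrite -subr_eq0 -normr_le0 leNgt; apply/negP => ub0.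
  have N0 : 0 < 1 + norm1 x by rewrite ltr_pwDl// norm1_ge0.
  have [n _ /(_ n (leqnn n)) /= nP] :=
    near_infty_natSinv_lt (PosNum (divr_gt0 ub0 N0)).
  by have := Fx n I; rewrite /F /strip /= leNgt -ltr_pdivlMr// nP.
have cvgF : mu \o F @ \oo --> 0%E.
  rewrite -(mu_hyperplane b u0) -FI; apply: nonincreasing_cvg_mu.
  - by rewrite [X in (X < _)%E](massE (measurable_strip u b _)) ltry.
  - by move=> n; exact: measurable_strip.
  - by rewrite FI; exact: measurable_hyperplane.
  - move=> n n' nn'; apply/subsetPset => x; rewrite /F /strip /= => /le_trans;
    apply.
    rewrite ler_wpM2r ?addr_ge0 ?norm1_ge0// lef_pV2 ?posrE// ler_nat ltnS//.
have {}cvgF : mass \o F @ \oo --> (0 : R).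
  by have /fine_cvgP[] := cvgF.
have /cvgrPdist_lt /(_ e e0)[n _ /(_ n (leqnn n))] := cvgF.
rewrite /= sub0r normrN ger0_norm ?mass_ge0// => lt_e.
by exists n.+1%:R^-1 => //; rewrite invr_gt0.
Qed.

Lemma halfspace_strip u (v : 'rV[R]_d) b b' e s :
  (forall i, `|u ord0 i - v ord0 i| <= e) ->
  `|b - b'| <= e -> halfspace u b s `\` halfspace v b' s `<=` strip v b' e /\
  halfspace v b' s `\` halfspace u b s `<=` strip v b' e.
Proof.
move=> uv bb.
have H x : `|(dot v x - b') - (dot u x - b)| <= e * (1 + norm1 x).
  have -> : dot v x - b' - (dot u x - b) = - (dot u x - dot v x) + (b - b')
    by ring.
  rewrite (le_trans (ler_normD _ _))// mulrDr mulr1 addrC lerD//.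
  by rewrite normrN; exact: dot_bound.
by split => x; rewrite /halfspace /strip /=; case: s => -[h1 /negP];
  rewrite -ltNge => h2; have := H x; rewrite !ler_norml; lra.
Qed.

Section cells.
Variables (T : topologicalType) (I : finType).
Variables (u : I -> T -> 'rV[R]_d) (b : I -> T -> R) (s : I -> bool).

Definition cell (t : T) : set (euclidean R d) :=
  [set x | forall i, halfspace (u i t) (b i t) (s i) x].

Lemma measurable_cell t : measurable (cell t).
Proof. by apply: measurable_forall => i; exact: measurable_halfspace. Qed.

(** Cells for nearby parameters differ only inside the union of the strips around the bounding
    hyperplanes. *)
Lemma mass_cell_continuous t :
  (forall i, u i t != 0) -> (forall i, {for t, continuous (u i)}) ->
  (forall i, {for t, continuous (b i)}) ->
  {for t, continuous (fun t => mass (cell t))}.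
Proof.
move=> u0 uc bc; apply/cvgrPdist_le => e e0.
(* The added 1 keeps the denominator positive when [I] is empty. *)
have eI : 0 < e / (#|I|%:R + 1) by rewrite divr_gt0// ltr_wpDl.
have /choice[r rP] : forall i, exists r, 0 < r /\
    mass (strip (u i t) (b i t) r) < e / (#|I|%:R + 1).
  by move=> i; have [r r0 rs] := strip_small (b i t) (u0 i) eI; exists r.
have [mE leE] := mass_exists_le (fun i =>
  measurable_strip (u i t) (b i t) (r i)).
have leEe : mass [set x | exists i, strip (u i t) (b i t) (r i) x] <= e.
  rewrite (le_trans leE)// (@le_trans _ _ (\sum_(i : I) e / (#|I|%:R + 1)))//.
    by apply: ler_sum => i _; exact: ltW (rP i).2.
  rewrite sumr_const -[X in X <= _]mulr_natr -mulrA ger_pMr// ler_pdivrMl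
    ?ltr_wpDl//.
  by rewrite mulr1 lerDl.
have near_i : \forall t' \near t, forall i,
    (forall k, `|u i t ord0 k - u i t' ord0 k| <= r i) /\ `|b i t - b i t'| <= r
      i.
  apply: (@filter_forall _ _ (fun i t' => (forall k,
    `|u i t ord0 k - u i t' ord0 k| <= r i) /\
    `|b i t - b i t'| <= r i) (nbhs t)) => i; have ri := (rP i).1.
  have nu : \forall t' \near t, ball (u i t) (r i) (u i t').
    by apply: (uc i); apply/nbhs_ballP; exists (r i).
  have nb : \forall t' \near t, ball (b i t) (r i) (b i t').
    by apply: (bc i); apply/nbhs_ballP; exists (r i).
  apply: filterS2 nu nb => t' [_ ut] bt; split => [k|]; last exact: ltW.
  by apply: ltW; exact: ut.
apply: filterS near_i => t' t'P; rewrite distrC.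
apply: le_trans leEe; apply: mass_diff_le => //; try exact: measurable_cell.
  move=> x [xt' /existsNP[i xt]]; exists i.
  have [H1 H2] := t'P i.
  have [] := @halfspace_strip (u i t') (u i t) (b i t') (b i t) (r i) (s i).
  - by move=> k; rewrite distrC.
  - by rewrite distrC.
  - by move=> + _; apply; split => //; exact: xt'.
move=> x [xt /existsNP[i xt']]; exists i.
have [H1 H2] := t'P i.
have [] := @halfspace_strip (u i t') (u i t) (b i t') (b i t) (r i) (s i).
- by move=> k; rewrite distrC.
- by rewrite distrC.
- by move=> _; apply; split => //; exact: xt.
Qed.

End cells.
End Mass.

(** * Distribution functions and quantiles in a direction *)

Section Quantile.
Variables (R : realType) (d : nat).
Variable mu : {finite_measure set (euclidean R d) -> \bar R}.
Hypothesis mu_hyperplane : forall (u : 'rV[R]_d) b, u != 0 ->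
  mu [set x | dot u x = b] = 0%E.
Hypothesis mu_open : forall U : set 'rV[R]_d, open U -> U !=set0 ->
  (0 < mu U)%E.
Implicit Types (u : 'rV[R]_d) (b p : R).

Definition total : R := mass mu setT.
Definition cdf u b : R := mass mu (halfspace u b false).

Lemma mass_open_gt0 (U : set 'rV[R]_d) : open U -> U !=set0 -> 0 < mass mu U.
Proof.
move=> oU U0; have mU : measurable (U : set (euclidean R d)).
  exact: sub_sigma_algebra.
by rewrite -lte_fin -massE//; exact: mu_open.
Qed.

Lemma total_gt0 : 0 < total.
Proof. by apply: (@mass_open_gt0 setT); [exact: openT|exists 0]. Qed.

Lemma mass_hyperplane u b : u != 0 -> mass mu [set x | dot u x = b] = 0.
Proof. by move=> u0; rewrite /mass mu_hyperplane. Qed.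

Lemma mass_halfspaceN u b : u != 0 ->
  mass mu (halfspace u b true) = total - cdf u b.
Proof.
move=> u0; apply/eqP; rewrite -subr_eq0 -normr_le0 -(mass_hyperplane b u0).
have mC : measurable (~` halfspace u b false : set (euclidean R d)).
  by apply: measurableC; exact: measurable_halfspace.
have -> : total - cdf u b = mass mu (~` halfspace u b false).
  rewrite /total (mass_setID mu (measurableT) (measurable_halfspace u b false))
    setTI.
  by rewrite setTD addrC addKr.
apply: (mass_diff_le mu (measurable_halfspace _ _ _) mC (measurable_hyperplane _
  _)).
  move=> x; rewrite /halfspace /= => -[bx /contrapT xb].
  by apply/eqP; rewrite eq_le bx xb.
by move=> x; rewrite /halfspace /= => -[/negP + /negP]; rewrite -!ltNge; lra.
Qed.

(** The open slab between the two hyperplanes is nonempty, hence of positive mass. *)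
Lemma cdf_lt u b b' : u != 0 -> b < b' -> cdf u b < cdf u b'.
Proof.
move=> u0 bb'; pose S : set 'rV[R]_d := dot u @^-1` `]b, b'[%classic.
have oS : open S.
  apply: (@open_comp _ _ (dot u)); last exact: interval_open.
  by move=> x _; exact: dot_continuous.
have uu := dot_gt0 u0.
have S0 : S !=set0.
  (* This multiple of [u] lies midway between the two hyperplanes. *)
  exists (((b + b') / 2 / dot u u) *: u).
  rewrite /S /= in_itv /= dotZr divfK ?gt_eqF//; lra.
have mS : measurable (S : set (euclidean R d)) by exact: sub_sigma_algebra.
rewrite -subr_gt0 (lt_le_trans (mass_open_gt0 oS S0))// lerBrDr addrC /cdf
  -massU//.
- apply: le_mass; [|exact: measurable_halfspace|].
    by apply: measurableU => //; exact: measurable_halfspace.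
  by move=> x [|]; rewrite /S /halfspace /= ?in_itv /=;
    [lra|move=> /andP[_ /ltW]].
- exact: measurable_halfspace.
- by rewrite -subset0 => x []; rewrite /S /halfspace /= in_itv /=; lra.
Qed.

Lemma cdf_inj u b b' : u != 0 -> cdf u b = cdf u b' -> b = b'.
Proof.
move=> u0 e; case: (ltgtP b b') => // /(cdf_lt u0); by rewrite e ltxx.
Qed.

Lemma cdf_continuous (T : topologicalType) (u : T -> 'rV[R]_d) (b : T -> R) t :
  u t != 0 -> {for t, continuous u} -> {for t, continuous b} ->
  {for t, continuous (fun t => cdf (u t) (b t))}.
Proof.
move=> u0 uc bc.
have -> : (fun t => cdf (u t) (b t)) =
    (fun t => mass mu (cell (fun _ : unit => u) (fun=> b) (fun=> false) t)).
  apply/funext => t'; congr mass; apply/seteqP; split => x.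
    by move=> Hx [].
  by move=> /(_ tt).
by apply: mass_cell_continuous.
Qed.

Lemma cdf_near_total u p : p < total ->
  exists b0, forall b, b0 <= b -> p < cdf u b.
Proof.
move=> pT; pose F n : set (euclidean R d) := halfspace u n%:R false.
have FU : \bigcup_n F n = setT.
  rewrite -subTset => x _; have [n _ /(_ n (leqnn n)) xn] :=
    nbhs_infty_ger (dot u x).
  by exists n.
have cvgF : mu \o F @ \oo --> mu setT.
  rewrite -FU; apply: nondecreasing_cvg_mu.
  - by move=> n; exact: measurable_halfspace.
  - by rewrite FU.
  - move=> n n' nn'; apply/subsetPset => x;
    rewrite /F /halfspace /= => /le_trans; apply.
    by rewrite ler_nat.
have {}cvgF : mass mu \o F @ \oo --> total.
  have e : mu setT = total%:E by exact: massE.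
  by move: cvgF; rewrite e => /fine_cvgP[].
have /(cvgr_gt _ cvgF) [n _ /(_ n (leqnn n)) /= pn] := pT.
exists n%:R => b nb; apply: (lt_le_trans pn); apply: le_mass;
  try exact: measurable_halfspace.
by move=> x; rewrite /F /halfspace /= => /le_trans; apply.
Qed.

Lemma cdf_near0 u p : u != 0 -> 0 < p ->
  exists b0, forall b, b <= b0 -> cdf u b < p.
Proof.
move=> u0 p0; have [|b0 b0P] := @cdf_near_total (- u) (total - p).
  by rewrite ltrBlDr ltrDl.
exists (- b0) => b bb0; have := b0P (- b); rewrite lerNr => /(_ bb0).
have -> : cdf (- u) (- b) = total - cdf u b.
  rewrite -mass_halfspaceN//; congr mass; apply/seteqP.
  by split => x; rewrite /halfspace /= dotNl lerN2.
lra.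
Qed.

Lemma cdf_surj u p : u != 0 -> 0 < p < total -> exists b, cdf u b = p.
Proof.
move=> u0 /andP[p0 pT]; have [b1 H1] := cdf_near0 u0 p0.
have [b2 H2] := cdf_near_total u pT.
pose a := Num.min b1 b2; pose c := Num.max b1 b2.
have ac : a <= c by rewrite ge_min !le_max lexx.
have ap : cdf u a < p by apply: H1; rewrite /a ge_min lexx.
have pc : p < cdf u c by apply: H2; rewrite /c le_max lexx orbT.
have [||b _ bp] := @IVT R (cdf u) a c p ac; last by exists b.
  apply: continuous_subspaceT => b.
  by apply: (@cdf_continuous _ (fun=> u) id) => //; exact: cvg_cst.
by rewrite ge_min le_max (ltW ap) (ltW pc) orbT.
Qed.

(** For 0 < p < total the value is unique by strict monotonicity; 0 is the default where none
    exists. *)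
Definition quantile u p : R := xget 0 [set b | cdf u b = p].

Lemma cdf_quantile u p : u != 0 -> 0 < p < total -> cdf u (quantile u p) = p.
Proof. by move=> u0 pT; apply: (@xgetPex _ _ [set b | cdf u b = p]);
  exact: cdf_surj. Qed.

Lemma quantile_lt u p p' : u != 0 -> 0 < p -> p < p' -> p' < total ->
  quantile u p < quantile u p'.
Proof.
move=> u0 p0 pp' p'T; rewrite ltNge; apply/negP.
have := cdf_quantile u0 (p := p); have := cdf_quantile u0 (p := p').
rewrite p0 p'T (lt_trans pp')// (lt_trans p0)// => /(_ isT) e' /(_ isT) e.
rewrite le_eqVlt => /predU1P[q|/(cdf_lt u0)]; last by rewrite e e'; lra.
by move: pp'; rewrite -e -e' q ltxx.
Qed.

(** Reversing the normal exchanges the mass below a hyperplane with the mass above it. *)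
Lemma quantileN u p : u != 0 -> 0 < p < total ->
  quantile (- u) (total - p) = - quantile u p.
Proof.
move=> u0 /andP[p0 pT]; have Nu0 : - u != 0 by rewrite oppr_eq0.
apply: (cdf_inj Nu0); rewrite cdf_quantile//; last by lra.
rewrite -[in LHS](cdf_quantile u0 (p := p)) ?p0// -mass_halfspaceN//.
congr mass; apply/seteqP.
by split => x; rewrite /halfspace /= dotNl lerN2.
Qed.

(** By strict monotonicity [p] lies strictly between the masses at b - e and b + e; this persists
    near [t] by continuity of [cdf] and traps the quantile. *)
Lemma quantile_continuous (T : topologicalType) (u : T -> 'rV[R]_d) p t :
  u t != 0 -> 0 < p < total -> {for t, continuous u} ->
  {for t, continuous (fun t => quantile (u t) p)}.
Proof.
move=> u0 pT uc; apply/cvgrPdist_lt => e e0; set b := quantile _ _.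
have bp : cdf (u t) b = p by exact: cdf_quantile.
have lo : \forall t' \near t, cdf (u t') (b - e) < p.
  apply: (cvgr_lt (cdf (u t) (b - e))).
    by apply: (@cdf_continuous _ u (fun=> b - e)) => //; exact: cvg_cst.
  by rewrite -[ltRHS]bp; apply: cdf_lt => //; rewrite ltrBlDr ltrDl.
have hi : \forall t' \near t, p < cdf (u t') (b + e).
  apply: (cvgr_gt (cdf (u t) (b + e))).
    by apply: (@cdf_continuous _ u (fun=> b + e)) => //; exact: cvg_cst.
  by rewrite -[ltLHS]bp; apply: cdf_lt => //; rewrite ltrDl.
have [i ui] : exists i, u t ord0 i != 0.
  apply: contrapT => H; move/eqP: u0; apply; apply/rowP => i.
  by rewrite mxE; apply/eqP/negPn/negP => Hi; apply: H; exists i.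
have nz : \forall t' \near t, u t' != 0.
  have : \forall t' \near t, ball (u t) `|u t ord0 i| (u t').
    by apply: uc; apply/nbhs_ballP; exists `|u t ord0 i|; rewrite //= normr_gt0.
  apply: filterS => t' [_ /(_ ord0 i)]; rewrite /ball /=.
  by apply: contraTneq => ->; rewrite mxE subr0 ltxx.
apply: filterS2 (filterI lo hi) nz => t' [lo' hi'] nz'.
have q' : cdf (u t') (quantile (u t') p) = p by exact: cdf_quantile.
rewrite distrC ltr_distl; apply/andP; split; rewrite ltNge; apply/negP;
  rewrite le_eqVlt => /predU1P[E|/(cdf_lt nz')]; rewrite ?q'; first 1 last.
- lra.
- by move: hi'; rewrite E q' ltxx.
- lra.
- by move: lo'; rewrite -E q' ltxx.
Qed.

End Quantile.

(** * The test map *)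

Lemma mass_distribution_hyperplane (R : realType) d
    (mu : {finite_measure set (euclidean R d) -> \bar R}) (u : 'rV[R]_d) b :
  mass_distribution mu -> u != 0 -> mu [set x | dot u x = b] = 0%E.
Proof.
move=> [[f [fint muf]] _] u0; have mH := measurable_hyperplane u b.
rewrite muf// null_set_integral//; last exact: lebesgue_hyperplane.
by apply: (measurable_funS measurableT) => //; exact: measurable_int fint.
Qed.

(** * Fourier analysis on (Z/2)^n *)

Section Fourier.
Variables (R : realType) (n : nat).
Implicit Types c x y : {ffun 'I_n -> bool}.

Definition character c x : R := \prod_i (-1) ^+ (c i && x i).

(** The sum over [c] factors over the coordinates, and a coordinate where [x] and [y] differ gives
    the factor 1 - 1. *)
Lemma character_orthogonal x y :
  \sum_c character c x * character c y = if x == y then 2 ^+ n else 0.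
Proof.
under eq_bigr => c _ do rewrite /character -big_split /=.
rewrite -(bigA_distr_bigA (fun i (b : bool) =>
  (-1) ^+ (b && x i) * (-1) ^+ (b && y i))).
case: eqP => [->|xy].
  rewrite -[n in RHS]card_ord -prodr_const; apply: eq_bigr => i _.
  by rewrite big_bool -expr2 sqrr_sign /= expr0 mulr1.
have [i xyi] : exists i, x i != y i.
  apply: contrapT => H; apply: xy; apply/ffunP => i.
  by apply/eqP/negPn/negP => Hi; apply: H; exists i.
rewrite (bigD1 i)//= big_bool /= -signr_addb; move: xyi.
by case: (x i); case: (y i) => // _; rewrite /= ?expr0 ?expr1 ?mulr1 addNr
  mul0r.
Qed.

(** Fourier inversion, in which only the trivial character contributes. *)
Lemma fourier_const (F : {ffun 'I_n -> bool} -> R) :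
  (forall c, c != [ffun=> false] -> \sum_x character c x * F x = 0) ->
  forall x, 2 ^+ n * F x = \sum_y F y.
Proof.
move=> F0 x.
transitivity (\sum_c character c x * \sum_y character c y * F y).
  under eq_bigr => c _ do rewrite mulr_sumr.
  rewrite exchange_big /= (bigD1 x)//= [X in _ + X]big1 ?addr0.
    under eq_bigr => c _ do rewrite mulrA.
    by rewrite -mulr_suml character_orthogonal eqxx.
  move=> y yx; under eq_bigr => c _ do rewrite mulrA.
  by rewrite -mulr_suml character_orthogonal eq_sym (negbTE yx) mul0r.
rewrite (bigD1 [ffun=> false])//= [X in _ + X]big1 ?addr0; last by move=> c cN0;
  rewrite F0 ?mulr0.
have c0 y : character [ffun=> false] y = 1.
  by rewrite /character big1// => i _; rewrite ffunE.
by rewrite c0 mul1r; apply: eq_bigr => y _; rewrite c0 mul1r.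
Qed.

Definition toggle (i : 'I_n) x : {ffun 'I_n -> bool} := [ffun q =>
  x q (+) (q == i)].

Lemma toggleK i : involutive (toggle i).
Proof. by move=> x; apply/ffunP => q; rewrite !ffunE addbK. Qed.

Lemma character_toggle c i x :
  character c (toggle i x) = (-1) ^+ c i * character c x.
Proof.
rewrite /character (bigD1 i)//= [in RHS](bigD1 i)//= mulrA; congr (_ * _).
  rewrite ffunE eqxx addbT -signr_addb; congr (_ ^+ _).
  by case: (c i); case: (x i).
by apply: eq_bigr => q /negbTE qi; rewrite ffunE qi addbF.
Qed.

Lemma character_unitform i x : character (unitform i) x = (-1) ^+ x i.
Proof.
rewrite /character (bigD1 i)//= big1 ?mulr1 => [|q]; rewrite ffunE ?eqxx//.
by rewrite eq_sym => /negbTE ->.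
Qed.

End Fourier.

Lemma row_continuous (R : realType) m d (i : 'I_m) (Y : 'M[R]_(m, d)) :
  {for Y, continuous (fun Y : 'M[R]_(m, d) => row i Y)}.
Proof.
move=> A [P YP PA].
have : \forall Z \near Y, forall j, P ord0 j ((Z : 'M[R]_(m, d)) i j).
  apply: (@filter_forall _ _ (fun j (Z : 'M[R]_(m, d)) =>
    P ord0 j (Z i j)) (nbhs Y)) => j.
  apply: (@coord_continuous R m d i j Y); have := YP ord0 j; by rewrite mxE.
by apply: filterS => Z PZ; apply: PA => i0 j; rewrite (ord1 i0) mxE.
Qed.

(** * Box masses as functions of the normal vectors *)

Section TestMap.
Variables (R : realType) (d n k : nat).
Variable mu : {finite_measure set (euclidean R d) -> \bar R}.
Hypothesis mu_hyperplane : forall (u : 'rV[R]_d) b, u != 0 ->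
  mu [set x | dot u x = b] = 0%E.
Hypothesis mu_open : forall U : set 'rV[R]_d, open U -> U !=set0 ->
  (0 < mu U)%E.

Notation l := (2 * k + 1)%N.
Notation T := (total mu).
Implicit Types (Y : 'M[R]_(n.+1, d)) (i : 'I_l.+1) (y : {ffun 'I_n -> bool}).
Implicit Types (r : 'I_l) (j : 'I_n).

Let T0 : 0 < T. Proof. exact: total_gt0. Qed.

(** Numbering starts at 0, so [r + 1] of the [l + 1] slabs lie below the hyperplane [r]. *)
Definition level (r : nat) : R := T * r.+1%:R / l.+1%:R.

Lemma level_bound r : 0 < level r < T.
Proof.
rewrite /level divr_gt0 ?mulr_gt0//= ltr_pdivrMr// ltr_pM2l// ltr_nat ltnS.
exact: ltn_ord.
Qed.

Definition par_offset r Y : R := quantile mu (row ord0 Y) (level r).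
Definition median j Y : R := quantile mu (row (lift ord0 j) Y) (T / 2).

(** A single index type for both families of hyperplanes makes each box a [cell]. *)
Definition all_normal (a : 'I_l + 'I_n) Y : 'rV[R]_d :=
  if a is inr j then row (lift ord0 j) Y else row ord0 Y.
Definition all_offset (a : 'I_l + 'I_n) Y : R :=
  match a with inl r => par_offset r Y | inr j => median j Y end.
Definition side i y (a : 'I_l + 'I_n) : bool :=
  match a with inl r => (r < i)%N | inr j => y j end.

Definition pbox Y i y : set (euclidean R d) :=
  cell all_normal all_offset (side i y) Y.

Definition box_mass Y i y : R := mass mu (pbox Y i y).

Let half_bound : 0 < T / 2 < T.
Proof. by have := T0; lra. Qed.

Lemma all_normal_neq0 Y a : nonzero_rows Y -> all_normal a Y != 0.
Proof. by case: a => [r|j] Y0; exact: Y0. Qed.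

Lemma box_mass_continuous Y i y : nonzero_rows Y ->
  {for Y, continuous (fun Y => box_mass Y i y)}.
Proof.
move=> Y0; apply: mass_cell_continuous => //.
- by move=> a; exact: all_normal_neq0.
- by case=> [r|j]; exact: row_continuous.
case=> [r|j].
  apply: (quantile_continuous mu_hyperplane mu_open (Y0 ord0) (level_bound r)).
  exact: row_continuous.
apply: (quantile_continuous mu_hyperplane mu_open (Y0 (lift ord0 j))
  half_bound).
exact: row_continuous.
Qed.

Lemma row_flip_row (i' : 'I_n.+1) Y : row i' (flip_row i' Y) = - row i' Y.
Proof. by apply/rowP => q; rewrite !mxE eqxx. Qed.

Lemma row_flip_row_neq (i1 i2 : 'I_n.+1) Y : i1 != i2 ->
  row i1 (flip_row i2 Y) = row i1 Y.
Proof. by move=> /negbTE ii; apply/rowP => q; rewrite !mxE ii. Qed.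

Lemma halfspaceN (u : 'rV[R]_d) b s : halfspace (- u) (- b) s = halfspace u b
  (~~ s).
Proof.
by apply/seteqP; split => x; rewrite /halfspace /= dotNl; case: s => /=;
  rewrite lerN2.
Qed.

(** For the reversed normal, the quantile at a level is minus the one at the complementary level, so
    the slabs are met in the opposite order. *)
Lemma pbox_flip0 Y i y : nonzero_rows Y ->
  pbox (flip_row ord0 Y) i y = pbox Y (rev_ord i) y.
Proof.
move=> Y0.
have offN r : par_offset r (flip_row ord0 Y) = - par_offset (rev_ord r) Y.
  rewrite /par_offset row_flip_row -quantileN//; last exact: level_bound.
  congr quantile; rewrite /level /= -[X in X - _](mulfK (_ : l.+1%:R != 0 :>
    R))//.
  rewrite -mulrBl -mulrBr -natrB; last by have := ltn_ord r; lia.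
  by congr (_ * _%:R / _); have := ltn_ord r; lia.
have medE j : median j (flip_row ord0 Y) = median j Y.
  by rewrite /median row_flip_row_neq.
have hE r : halfspace (row ord0 (flip_row ord0 Y)) (par_offset r (flip_row ord0
  Y)) (r < i)%N
    = halfspace (row ord0 Y) (par_offset (rev_ord r) Y) (rev_ord r < rev_ord
      i)%N.
  rewrite row_flip_row offN halfspaceN; congr halfspace.
  by rewrite /=; have := ltn_ord r; have := ltn_ord i; lia.
apply/seteqP; split => x xb.
  case=> [r|j]; last by have := xb (inr j); rewrite /= medE row_flip_row_neq.
  by have := xb (inl (rev_ord r)); rewrite /= hE rev_ordK.
case=> [r|j]; last by have := xb (inr j); rewrite /= medE row_flip_row_neq.
by rewrite /= hE; exact: xb (inl (rev_ord r)).
Qed.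

(** The median hyperplane stays the same and its two sides are exchanged. *)
Lemma pbox_flip_lift Y i y j : nonzero_rows Y ->
  pbox (flip_row (lift ord0 j) Y) i y = pbox Y i (toggle j y).
Proof.
move=> Y0.
have offE r : par_offset r (flip_row (lift ord0 j) Y) = par_offset r Y.
  by rewrite /par_offset row_flip_row_neq.
have hE j' : halfspace (row (lift ord0 j') (flip_row (lift ord0 j) Y))
    (median j' (flip_row (lift ord0 j) Y)) (y j')
    = halfspace (row (lift ord0 j') Y) (median j' Y) (toggle j y j').
  rewrite ffunE /median; have [->|jj] := eqVneq j' j.
    rewrite row_flip_row addbT -halfspaceN -quantileN//.
    by congr (halfspace _ (quantile _ _ _)); lra.
  by rewrite addbF row_flip_row_neq// (inj_eq lift_inj).
by apply/seteqP; split => x xb; (case=> [r|j']; [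
  have := xb (inl r); rewrite /= offE row_flip_row_neq//|
  have := xb (inr j'); rewrite /= hE]).
Qed.

(* Reversing the common normal exchanges the two regions of a pair. *)
Definition region_of (p : 'I_k.+1 * bool) : 'I_l.+1 :=
  if p.2 then rev_ord (inord p.1) else inord p.1.

Lemma region_of_bij : bijective region_of.
Proof.
apply: inj_card_bij; last by rewrite card_prod card_bool !card_ord; lia.
have inoK (a : 'I_k.+1) : (inord a : 'I_l.+1) = a :> nat.
  by rewrite inordK//; have := ltn_ord a; lia.
move=> [a e] [a' e'] /(congr1 val); have := ltn_ord a; have := ltn_ord a'.
rewrite /region_of /=; case: e; case: e' => /=; rewrite !inoK => ha ha' e;
  try (by exfalso; lia); by congr (_, _); apply/val_inj => /=; lia.
Qed.

(** The first bit selects a slab of the pair [a], the other bits the half-spaces; flipping a normal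
    vector then toggles one bit. *)
Definition orbit_mass Y (a : 'I_k.+1) (x : {ffun 'I_n.+1 -> bool}) : R :=
  box_mass Y (region_of (a, x ord0)) (ffun_tail x).

Lemma orbit_mass_flip Y a x (i' : 'I_n.+1) : nonzero_rows Y ->
  orbit_mass (flip_row i' Y) a x = orbit_mass Y a (toggle i' x).
Proof.
move=> Y0; rewrite /orbit_mass /box_mass.
case: (unliftP ord0 i') => [j|] ->.
  rewrite pbox_flip_lift//; congr (mass _ (pbox _ (region_of (_, _)) _)).
    by rewrite ffunE addbF.
  by apply/ffunP => q; rewrite !ffunE (inj_eq lift_inj).
rewrite pbox_flip0//; congr (mass _ (pbox _ _ _)).
  by rewrite /region_of ffunE /= eqxx addbT; case: (x ord0); rewrite ?rev_ordK.
by apply/ffunP => q; rewrite !ffunE addbF.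
Qed.

Definition test_fun (p : 'I_k.+1 * {ffun 'I_n.+1 -> bool}) Y : R :=
  \sum_x character R p.2 x * orbit_mass Y p.1 x.

Lemma test_fun_flip p (i' : 'I_n.+1) Y : nonzero_rows Y ->
  test_fun p (flip_row i' Y) = (-1) ^+ p.2 i' * test_fun p Y.
Proof.
move=> Y0; rewrite /test_fun mulr_sumr (reindex_inj (inv_inj (toggleK i'))) /=.
apply: eq_bigr => x _.
by rewrite orbit_mass_flip// toggleK character_toggle mulrA.
Qed.

Lemma test_fun_continuous p Y : nonzero_rows Y -> {for Y,
  continuous (test_fun p)}.
Proof.
move=> Y0.
apply: (@sum_continuous_at R _ _
  (fun x Y => character R p.2 x * orbit_mass Y p.1 x)) => x.
apply: (@cvgM _ _ (nbhs Y) _ (fun=> character R p.2 x)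
  (fun Y => orbit_mass Y p.1 x)); first exact: cvg_cst.
exact: box_mass_continuous.
Qed.

Lemma par_offset_lt Y r r' : nonzero_rows Y -> (r < r')%N ->
  par_offset r Y < par_offset r' Y.
Proof.
move=> Y0 rr'; have /andP[lr _] := level_bound r;
  have /andP[_ lr'] := level_bound r'.
apply: quantile_lt => //; rewrite /level ltr_pM2r ?invr_gt0// ltr_pM2l//.
by rewrite ltr_nat ltnS.
Qed.

(** The offsets increase, so the hyperplanes at or below [z] form an initial segment. *)
Lemma region_index Y z : nonzero_rows Y ->
  exists i, forall r, (par_offset r Y <= dot (row ord0 Y) z) = (r < i)%N.
Proof.
move=> Y0; pose Q (i : nat) := [forall r : 'I_l, (i <= r)%N ==>
  (dot (row ord0 Y) z < par_offset r Y)].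
have [|i /forallP Qi imin] := @ex_minnP Q.
  by exists l; apply/forallP => r; rewrite leqNgt ltn_ord.
have il : (i < l.+1)%N.
  by rewrite ltnS; apply: imin; apply/forallP => r; rewrite leqNgt ltn_ord.
exists (Ordinal il) => r /=; apply/idP/idP => [zr|ri].
  rewrite ltnNge; apply/negP => ir; have := Qi r; rewrite ir /=.
  by rewrite ltNge zr.
rewrite leNgt; apply/negP => zr; have : Q r.
  apply/forallP => r'; apply/implyP; rewrite leq_eqVlt =>
    /predU1P[/val_inj <- //|rr'].
  by apply: lt_trans zr _; exact: par_offset_lt.
by move=> /imin; rewrite leqNgt ri.
Qed.

Section sums.
Notation idx := ('I_l.+1 * {ffun 'I_n -> bool})%type.
Variable Y : 'M[R]_(n.+1, d).
Hypothesis Y0 : nonzero_rows Y.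
Variable rho : euclidean R d -> 'I_l.+1.
Hypothesis rhoP : forall z r, (par_offset r Y <= dot (row ord0 Y) z) = (r < rho
  z)%N.

(** Together with [rho] this partitions the space, whereas closed boxes overlap along hyperplanes;
    the masses of the fibres add up exactly. *)
Definition sides (z : euclidean R d) : {ffun 'I_n -> bool} :=
  [ffun j => median j Y <= dot (row (lift ord0 j) Y) z].

Lemma sides_fiber i y : (fun z => (rho z, sides z)) @^-1` [set (i, y)] =
  [set z | forall a, (all_offset a Y <= dot (all_normal a Y) z) = side i y a].
Proof.
apply/seteqP; split => z /=.
  by move=> [<- <-] [r|j] /=; [exact: rhoP|rewrite ffunE].
move=> H; congr (_, _); last by apply/ffunP => j; rewrite ffunE;
  exact: (H (inr j)).
have E r : (r < rho z)%N = (r < i)%N by rewrite -rhoP; exact: (H (inl r)).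
apply/val_inj/eqP; rewrite eqn_leq; apply/andP.
split; rewrite leqNgt; apply/negP => h.
  have hl : (i < l)%N by rewrite (leq_trans h)// -ltnS ltn_ord.
  by have := E (Ordinal hl); rewrite /= h ltnn.
have hl : (rho z < l)%N by rewrite (leq_trans h)// -ltnS ltn_ord.
by have := E (Ordinal hl); rewrite /= h ltnn.
Qed.

Lemma measurable_sign (u : 'rV[R]_d) b (s : bool) :
  measurable [set z : euclidean R d | (b <= dot u z) = s].
Proof.
have mt := measurable_halfspace u b true; case: s.
  by rewrite (_ : [set _ | _] = halfspace u b true).
rewrite (_ : [set _ | _] = ~` halfspace u b true); first exact: measurableC.
by apply/seteqP; split => z; rewrite /halfspace /=;
  [move=> /negP|move=> /negP/negbTE].
Qed.

Lemma measurable_sides i y :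
  measurable ((fun z => (rho z, sides z)) @^-1` [set (i, y)]).
Proof. by rewrite sides_fiber; apply: measurable_forall => a;
  exact: measurable_sign. Qed.

(** The closed box and the fibre differ only on the bounding hyperplanes, which are null. *)
Lemma mass_sides i y :
  mass mu ((fun z => (rho z, sides z)) @^-1` [set (i, y)]) = box_mass Y i y.
Proof.
have mhyp a := measurable_hyperplane (all_normal a Y) (all_offset a Y).
have [mE] := mass_exists_le mu mhyp.
rewrite big1 => [leE|a _]; last exact/mass_hyperplane/all_normal_neq0.
apply/eqP; rewrite -subr_eq0 -normr_le0 (le_trans _ leE)//.
apply: mass_diff_le => //; [exact: measurable_sides|exact: measurable_cell| |];
    rewrite sides_fiber.
  move=> z [/= H []] a; have := H a; rewrite /halfspace /=.
  by case: (side i y a) => //= /negbT; rewrite -ltNge => /ltW.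
move=> z [H /existsNP[a Ha]]; exists a; have := H a; move: Ha.
rewrite /halfspace /=; case: (side i y a) => /=.
  by move=> + h; rewrite h.
case: leP => [h1 _ h2|_ []//].
by apply/eqP; rewrite eq_le h1 h2.
Qed.

Lemma sum_box_mass (Q : pred idx) :
  \sum_(p | Q p) box_mass Y p.1 p.2 = mass mu [set z | Q (rho z, sides z)].
Proof.
rewrite -(sum_mass_fibers mu Q (h := fun z => (rho z, sides z))); last first.
  by move=> [i y]; exact: measurable_sides.
by apply: eq_bigr => -[i y] _; rewrite mass_sides.
Qed.

Lemma sum_half j (s : bool) : \sum_(p : idx | p.2 j == s) box_mass Y p.1 p.2 = T
  / 2.
Proof.
have E : mass mu (halfspace (row (lift ord0 j) Y) (median j Y) true) = T / 2.
  rewrite mass_halfspaceN// /median cdf_quantile//; first by lra.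
rewrite (sum_box_mass (fun p : idx => p.2 j == s)).
have -> : [set z | sides z j == s] =
    [set z | (median j Y <= dot (row (lift ord0 j) Y) z) = s].
  by apply/seteqP; split => z /=; rewrite ffunE => /eqP.
case: s; first exact: E.
have := mass_setID mu measurableT (measurable_halfspace (row (lift ord0 j) Y)
  (median j Y) true).
rewrite setTI E setTD => TE.
have -> : [set z | (median j Y <= dot (row (lift ord0 j) Y) z) = false] =
    ~` halfspace (row (lift ord0 j) Y) (median j Y) true.
  by apply/seteqP; split => z; rewrite /halfspace /=;
    [move=> /negP|move=> /negP/negbTE].
by move: TE; rewrite -[mass mu setT]/T; lra.
Qed.

Lemma sum_below (a : nat) : (a <= l.+1)%N ->
  \sum_(p : idx | (p.1 < a)%N) box_mass Y p.1 p.2 =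
  T * a%:R / l.+1%:R.
Proof.
move=> al; rewrite (sum_box_mass (fun p : idx => (p.1 < a)%N)) /=.
(* The values 0 and [l + 1] have no bounding hyperplane; a value [a + 1] in between uses the
   hyperplane number [a]. *)
case: a al => [_|a].
  rewrite (_ : [set _ | _] = set0) ?mass0 ?mulr0 ?mul0r//.
  by rewrite -subset0 => z.
rewrite ltnS leq_eqVlt => /predU1P[->|al].
  rewrite (_ : [set _ | _] = setT) ?mulfK//.
  by apply/seteqP; split => z //= _; exact: ltn_ord.
have -> : [set z | (rho z < a.+1)%N] =
    ~` halfspace (row ord0 Y) (par_offset (Ordinal al) Y) true.
  by apply/seteqP; split => z; rewrite /halfspace /= rhoP /=
    [(rho z < _)%N]ltnS [(rho z <= _)%N]leqNgt => /negP.
have := mass_setID mu measurableT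
  (measurable_halfspace (row ord0 Y) (par_offset (Ordinal al) Y) true).
rewrite setTI setTD mass_halfspaceN// /par_offset cdf_quantile//;
  last exact: level_bound.
rewrite -[mass mu setT]/T => TE; rewrite -[RHS]/(level (Ordinal al)); lra.
Qed.

Lemma sum_region i : \sum_y box_mass Y i y = T / l.+1%:R.
Proof.
have := sum_below (ltn_ord i); rewrite (bigID (fun p : idx => (p.1 < i)%N)) /=.
have -> : \sum_(p : idx | (p.1 < i.+1)%N && (p.1 < i)%N)
    box_mass Y p.1 p.2 = T * i%:R / l.+1%:R.
  rewrite -sum_below; last exact: ltnW.
  by apply: eq_bigl => p; apply: andb_idl => /ltnW.
have -> : \sum_(p : idx | (p.1 < i.+1)%N && ~~ (p.1 < i)%N)
    box_mass Y p.1 p.2 = \sum_y box_mass Y i y.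
  transitivity (\sum_(p : idx | (p.1 == i) && xpredT p.2)
      box_mass Y p.1 p.2).
    by apply: eq_bigl => p; rewrite andbT -leqNgt ltnS -eqn_leq val_eqE.
  by rewrite -(pair_big (pred1 i) xpredT (box_mass Y)) /= big_pred1_eq.
by rewrite -[i.+1%:R]natr1 mulrDr mulr1 mulrDl => /addrI.
Qed.

Lemma sum_ffun_cons (V : zmodType) (F : {ffun 'I_n.+1 -> bool} -> V) :
  \sum_x F x = \sum_(e : bool) \sum_y F (ffun_cons e y).
Proof.
rewrite (reindex (fun p : bool * {ffun 'I_n -> bool} => ffun_cons p.1 p.2)) /=;
  last first.
  exact/onW_bij/ffun_cons_bij.
by rewrite pair_big.
Qed.

Lemma orbit_mass_cons a e y :
  orbit_mass Y a (ffun_cons e y) = box_mass Y (region_of (a, e)) y.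
Proof. by rewrite /orbit_mass ffun_cons0 ffun_tail_cons. Qed.

Lemma sum_orbit_mass a : \sum_x orbit_mass Y a x = 2 * (T / l.+1%:R).
Proof.
rewrite sum_ffun_cons.
under eq_bigr => e _ do (under eq_bigr => y _ do rewrite orbit_mass_cons;
  rewrite sum_region).
by rewrite big_bool /= -mulr2n mulr_natl.
Qed.

(** This coefficient compares the two slabs of a pair, which have equal mass. *)
Lemma test_fun_ord0 a : test_fun (a, unitform ord0) Y = 0.
Proof.
rewrite /test_fun sum_ffun_cons /=.
under eq_bigr => e _ do under eq_bigr => y _ do
  rewrite character_unitform ffun_cons0 orbit_mass_cons.
under eq_bigr => e _ do rewrite -mulr_sumr sum_region.
by rewrite big_bool /= expr1 expr0 mulN1r mul1r addNr.
Qed.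

(** The sum over all pairs of slabs compares the two sides of a median hyperplane. *)
Lemma sum_test_fun_lift j : \sum_a test_fun (a, unitform (lift ord0 j)) Y = 0.
Proof.
transitivity (\sum_(p : idx) (-1) ^+ p.2 j * box_mass Y p.1 p.2).
  rewrite -(pair_big xpredT xpredT (fun i (y : {ffun 'I_n -> bool}) =>
    (-1) ^+ y j * box_mass Y i y)) /=.
  rewrite [RHS](reindex region_of) /=; last exact/onW_bij/region_of_bij.
  rewrite -(pair_big xpredT xpredT (fun a e => \sum_(y : {ffun 'I_n -> bool})
    (-1) ^+ y j * box_mass Y (region_of (a, e)) y)) /=.
  apply: eq_bigr => a _; rewrite /test_fun sum_ffun_cons.
  apply: eq_bigr => e _; apply: eq_bigr => y _.
  by rewrite orbit_mass_cons character_unitform ffunE liftK.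
rewrite (bigID (fun p : idx => p.2 j == true)) /=.
rewrite (eq_bigr (fun p => - box_mass Y p.1 p.2)) => [|p /eqP ->]; last first.
  by rewrite expr1 mulN1r.
rewrite sumrN sum_half [X in _ + X](eq_bigr (fun p => box_mass Y p.1 p.2));
  last first.
  by move=> p; case: (p.2 j) => // _; rewrite expr0 mul1r.
rewrite (eq_bigl (fun p : idx => p.2 j == false)) ?sum_half ?addNr//.
by move=> p; case: (p.2 j).
Qed.

(** All nontrivial coefficients vanish, so the masses are constant on each pair of slabs, whose mass
    2T / (l + 1) is shared by 2^(n + 1) boxes. *)
Lemma box_mass_equal : (forall p, test_form ord0 p -> test_fun p Y = 0) ->
  forall i y, box_mass Y i y = T / (l.+1 * 2 ^ n)%:R.
Proof.
move=> test0 i y.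
have all0 a c : c != [ffun=> false] -> test_fun (a, c) Y = 0.
  move=> c0; have [->|cu] := eqVneq c (unitform ord0);
    first exact: test_fun_ord0.
  have [/imsetP[q]|pE] := boolP ((a, c) \in
    [set (ord0 : 'I_k.+1, unitform q) | q in [pred q : 'I_n.+1 | q !=
      ord0]]%SET); last first.
    by apply: test0; rewrite /test_form c0 cu.
  rewrite inE => q0 [-> ->]; case: (unliftP ord0 q) q0 => [j ->|->];
    last by rewrite eqxx.
  (* The sum over the pairs is zero and its other terms are tested, so the untested term at [ord0]
     vanishes too. *)
  move=> _; have := sum_test_fun_lift j;
    rewrite (bigD1 ord0)//= big1 ?addr0// => a' a'0.
  apply: test0; rewrite /test_form /= unitform_neq0 /= (inj_eq (@unitform_inj
    _)) /=.
  by apply/imsetP => -[q' _ [aE _]]; rewrite aE eqxx in a'0.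
have [g gK Kg] := region_of_bij; case: (g i) (Kg i) => a e ie.
have := fourier_const (F := orbit_mass Y a) _ (ffun_cons e y).
rewrite sum_orbit_mass orbit_mass_cons ie => H.
have {}H : 2 ^+ n.+1 * box_mass Y i y = 2 * (T / l.+1%:R).
  by apply: H => c c0; exact: all0.
apply: (@mulfI _ (2 ^+ n.+1)); first by rewrite expf_neq0.
rewrite H exprS natrM natrX invfM; field.
by rewrite expf_neq0//= pnatr_eq0.
Qed.

End sums.
End TestMap.

(** * The equipartition *)

(** For sides facing away from each other, the intersection is empty or lies in a common hyperplane;
    the sign of [a] and the order of the offsets determine these sides. *)
Lemma opposite_halfspaces (R : realType) d (u : 'rV[R]_d) a b b' : a != 0 ->
  exists s s', halfspace u b s `&` halfspace (a *: u) b' s' `<=` [set x | dot u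
    x = b].
Proof.
move=> a0; have [a_gt0|a_lt0] : 0 < a \/ a < 0 by case: (ltgtP a 0) a0;
  [right|left|].
  have [bb|bb] := leP b (b' / a).
    exists false, true => x; rewrite /halfspace /= dotZl => -[xb].
    rewrite mulrC -ler_pdivrMr// => bx; apply/eqP.
    by rewrite eq_le xb (le_trans bb bx).
  exists true, false => x; rewrite /halfspace /= dotZl => -[bx].
  rewrite mulrC -ler_pdivlMr// => xb.
  by have := lt_le_trans (le_lt_trans xb bb) bx; rewrite ltxx.
have [bb|bb] := leP b (b' / a).
  exists false, false => x; rewrite /halfspace /= dotZl => -[xb].
  rewrite mulrC -ler_ndivrMr// => bx; apply/eqP.
  by rewrite eq_le xb (le_trans bb bx).
exists true, true => x; rewrite /halfspace /= dotZl => -[bx].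
rewrite mulrC -ler_ndivlMr// => xb.
by have := lt_le_trans (le_lt_trans xb bb) bx; rewrite ltxx.
Qed.

(* Q is the polynomial P_m / x_1, and q the polynomial
   Q ^ (k + 1) / (x_2 ... x_m).  Both are determined by these equations, as
   polynomials over Z/2 form an integral domain, and they exist by
   dickson_divisible.  The ordinal i stands for the variable x_(i + 1). *)
Theorem theorem5p2 (R : realType) (m d k : nat)
    (hm : (2 <= m)%N) (hd : (1 <= d)%N)
    (Q q : mpoly m 'F_2)
    (hQ : mvar (Ordinal (ltnW hm)) * Q = dickson m)
    (hq : (\prod_(i < m | (0 < i)%N) mvar i) * q = Q ^+ k.+1)
    (hnotin : ~ ideal_generated (fun i : 'I_m => mvar i ^+ d) q)
    (mu : {finite_measure set (euclidean R d) -> \bar R})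
    (hmu : mass_distribution mu) :
  exists (G : 'I_(2 * k + 1) -> hyperplane R d)
         (H : 'I_(m - 1) -> hyperplane R d),
    [/\ parallel_collection G, non_parallel_to G H & equipartition mu G H].
Proof.
case: m hm Q q hQ hq hnotin => [//|[//|n0]] hm Q q hQ hq hnotin.
rewrite subn1 /=; set n := n0.+1 in hm Q q hQ hq hnotin *.
have mu_hyp (u : 'rV[R]_d) b : u != 0 -> mu [set x | dot u x = b] = 0%E.
  exact: mass_distribution_hyperplane.
have mu_open := hmu.2.
have i0E : Ordinal (ltnW hm) = ord0 by apply/val_inj.
rewrite i0E in hQ.
have hq' : (\prod_(i < n.+1 | i != ord0) mvar i) * q = Q ^+ k.+1.
  by rewrite -hq; congr (_ * _); apply: eq_bigl => i; rewrite -val_eqE /= lt0n.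
have qE := quotient_prod hQ hq'.
have [a qa ad] := not_ideal_mcoeff hnotin.
(* One test function for each linear factor of [q], so that the product of their forms is [q]. *)
pose J := {p in [pred p : 'I_k.+1 * {ffun 'I_n.+1 -> bool} | test_form ord0 p]}.
have [Y Y0 fY] : exists2 Y : 'M[R]_(n.+1, d), nonzero_rows Y &
    forall j : J, test_fun mu (val j) Y = 0.
  apply: (@borsuk_ulam_product R n.+1 d J (fun j => (val j).2)
    (fun j => test_fun mu (val j)) _ a) => //.
  - by move=> j i Y Y0; exact: test_fun_flip.
  - by move=> j Y Y0; exact: test_fun_continuous.
  - move: qa; rewrite qE.
    by rewrite (big_sub [pred p | test_form ord0 p]
      (fun p : 'I_k.+1 * {ffun 'I_n.+1 -> bool} => linear_form (boolform p.2))).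
have /choice[rho rhoP] := fun z => @region_index _ _ _ k mu mu_hyp mu_open Y z
  Y0.
have boxE := box_mass_equal mu_hyp mu_open Y0 rhoP (fun p pT =>
  fY (exist _ p pT)).
pose G (r : 'I_(2 * k + 1)) := Hyperplane (par_offset (k :=
  k) mu r Y) (Y0 ord0).
pose H (j : 'I_n) := Hyperplane (median mu j Y) (Y0 (lift ord0 j)).
have T0 := total_gt0 mu_open.
have boxS i s : box G H i s = pbox (k := k) mu Y i s.
  apply/seteqP; split => x.
    by move=> [xG xH] [r|j]; [exact: xG|exact: xH].
  by move=> xb; split => [r|j] _; [exact: (xb (inl r))|exact: (xb (inr j))].
have box_gt0 i s : 0 < mass mu (pbox (k := k) mu Y i s).
  by rewrite -/(box_mass (k := k) mu Y i s) boxE divr_gt0// ltr0n muln_gt0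
    expn_gt0.
(* A box inside a hyperplane would be null, but all boxes have the same positive mass. *)
have not_null i s (u : 'rV[R]_d) b : u != 0 ->
    ~ pbox (k := k) mu Y i s `<=` [set x | dot u x = b].
  move=> u0 sub; have := box_gt0 i s; rewrite ltNge => /negP; apply.
  rewrite -(mass_hyperplane mu_hyp b u0); apply: le_mass => //.
    exact: measurable_cell.
  exact: measurable_hyperplane.
exists G, H; split.
- by split => // r r' rr'; exact: par_offset_lt.
- split=> [r j|j j' jj'] [c /= cE].
    have c0 : c != 0.
      by apply: contraTneq (Y0 (lift ord0 j)) => c0; rewrite cE c0 scale0r eqxx.
    have [s [s' ss]] := opposite_halfspaces (row ord0 Y) (par_offset mu r Y)
      (median mu j Y) c0.
    (* The last slab lies above all the hyperplanes of the collection and the first one below, so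
       some box lies on the chosen sides of both hyperplanes. *)
    apply: (@not_null (if s then ord_max else ord0) [ffun=>
      s'] _ (par_offset mu r Y) (Y0 ord0)).
    move=> x xb; apply: ss; split.
      have := xb (inl r); rewrite /= => {xb}.
      by case: (s); rewrite /= ?ltn_ord.
    by have := xb (inr j); rewrite /= ffunE cE.
  have c0 : c != 0.
    by apply: contraTneq (Y0 (lift ord0 j')) => c0; rewrite cE c0 scale0r eqxx.
  have [s [s' ss]] := opposite_halfspaces (row (lift ord0 j) Y) (median mu j Y)
    (median mu j' Y) c0.
  (* As [j] and [j'] differ, both sides can be prescribed at once, in any slab. *)
  apply: (@not_null ord0 [ffun t => if t == j then s else s'] _ (median mu j Y)
    (Y0 (lift ord0 j))).
  move=> x xb; apply: ss; split.
    by have := xb (inr j); rewrite /= ffunE eqxx.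
  by have := xb (inr j'); rewrite /= ffunE eq_sym (negbTE jj') cE.
move=> i s; rewrite boxS massE; last exact: measurable_cell.
rewrite -/(box_mass (k := k) mu Y i s) boxE mulrC EFinM; congr (_ * _)%E.
by rewrite massE.
Qed.
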